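(* Let $\mathcal{A}:D(\mathcal{A})\subseteq\mathcal{E}\to\mathcal{E}$ generate the strongly continuous semigroup $(\mathcal{T}(t))_{t\ge0}$ on $\mathcal{E}=E\times F$, where $E$ and $F$ are Banach spaces. Let $A:D(A)\subseteq E\to E$ be the operator $$Ax:=\pi_1\bigl(\mathcal{A}\tbinom{x}{0}\bigr)\quad\text{for } x\in D(A):=\bigl\{z\in E:\tbinom{z}{0}\in D(\mathcal{A})\bigr\}.$$ Then $(\mathcal{T}(t))_{t\ge 0}$ has upper triangular form, i.e. $$\mathcal{T}(t)=\begin{pmatrix}T(t)&R(t)\\0&S(t)\end{pmatrix}\quad\text{for all }t\ge0,$$ if and only if the following two conditions are satisfied: (i) for all $x\in E$ with $\binom{x}{0}\in D(\mathcal{A})$ we have $\pi_2\bigl(\mathcal{A}\binom{x}{0}\bigr)=0$; (ii) there exists $\lambda\in\rho(A)$ satisfying $\operatorname{Re}\lambda>s(\mathcal{A})$. Moreover, in this case $(T(t))_{t\ge0}$ is a strongly continuous semigroup (on $E$) with generator $A$.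
   Context: $\pi_1:\mathcal{E}\to E$ and $\pi_2:\mathcal{E}\to F$ denote the projections onto the first and second coordinate; elements of $E\times F$ are written as columns $\binom{x}{y}$. Operators on $\mathcal{E}$ are written as $2\times2$ matrices, with $T(t)\in\mathcal{L}(E)$, $R(t)\in\mathcal{L}(F,E)$, $S(t)\in\mathcal{L}(F)$. $\rho(A)$ is the resolvent set of $A$, and $s(\mathcal{A})=\sup\{\operatorname{Re}\mu:\mu\in\sigma(\mathcal{A})\}$ is the spectral bound of $\mathcal{A}$. ''Semigroup'' means strongly continuous one-parameter semigroup of bounded linear operators ($C_0$-semigroup). *)

(* Defs.v *)
(* Normed spaces are complex: the scalars are R[i], for an arbitrary realType R. *)
From mathcomp Require Import all_boot all_order all_algebra.
From mathcomp Require Import complex.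
From mathcomp Require Import all_classical all_reals all_analysis.

Set Implicit Arguments.
Unset Strict Implicit.
Unset Printing Implicit Defensive.

Import Order.TTheory GRing.Theory Num.Theory.
Import numFieldNormedType.Exports.

Local Open Scope classical_set_scope.
Local Open Scope complex_scope.
Local Open Scope ring_scope.

Section Operators.
Context {R : realType}.

Definition bounded_operator {V W : normedModType R[i]} (f : V -> W) : Prop :=
  linear f /\ bounded_near f (nbhs (0 : V)).

(* A linear operator D(A) <= V -> V. The values of [op_fun] outside [op_dom]
   carry no meaning. *)
Record unbounded_operator (V : normedModType R[i]) := UnboundedOperator {
  op_dom : set V ;
  op_fun :> V -> V ;
  op_dom0 : op_dom 0 ;
  op_domP : forall (a : R[i]) (x y : V),
    op_dom x -> op_dom y -> op_dom (a *: x + y) ;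
  op_linear : forall (a : R[i]) (x y : V),
    op_dom x -> op_dom y -> op_fun (a *: x + y) = a *: op_fun x + op_fun y }.

Definition resolvent_set {V : normedModType R[i]} (A : unbounded_operator V) :
    set R[i] :=
  [set lambda | exists B : V -> V,
     [/\ bounded_operator B,
         forall y, op_dom A (B y) /\ lambda *: B y - A (B y) = y &
         forall x, op_dom A x -> B (lambda *: x - A x) = x]].

Definition spectrum {V : normedModType R[i]} (A : unbounded_operator V) :
    set R[i] :=
  ~` resolvent_set A.

(* Extended-real valued: -oo when the spectrum is empty. *)
Definition spectral_bound {V : normedModType R[i]} (A : unbounded_operator V) :
    \bar R :=
  ereal_sup [set (complex.Re mu)%:E | mu in spectrum A].

(* Only the values T t with 0 <= t matter. *)
Definition C0_semigroup {V : normedModType R[i]} (T : R -> V -> V) : Prop :=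
  [/\ forall t, 0 <= t -> bounded_operator (T t),
      T 0 = id,
      forall s t, 0 <= s -> 0 <= t -> T (s + t) = T s \o T t &
      forall x, {within `[0, +oo[, continuous (fun t => T t x)}].

(* Equality of graphs: x is in D(A) iff the right derivative of t |-> T t x
   at 0 exists, and then A x is that derivative. *)
Definition is_generator {V : normedModType R[i]} (T : R -> V -> V)
    (A : unbounded_operator V) : Prop :=
  forall x y : V, (op_dom A x /\ A x = y) <->
    ((h^-1)%:C *: (T h x - x) @[h --> 0^'+] --> y).

Section Product.
Context {E F : normedModType R[i]}.

Definition block_operator (a : E -> E) (b : F -> E) (c : E -> F) (d : F -> F) :
    E * F -> E * F :=
  fun z => (a z.1 + b z.2, c z.1 + d z.2).

Definition upper_triangular_form (TT : R -> E * F -> E * F)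
    (T : R -> E -> E) (U : R -> F -> E) (S : R -> F -> F) : Prop :=
  forall t, 0 <= t ->
    [/\ bounded_operator (T t), bounded_operator (U t),
        bounded_operator (S t) &
        TT t = block_operator (T t) (U t) (fun=> 0) (S t)].

Implicit Types A : unbounded_operator (E * F)%type.

Lemma pair0_linear (a : R[i]) (x y : E) :
  ((a *: x + y, 0) : E * F) = a *: (x, 0) + (y, 0).
Proof. by congr pair; rewrite /= scaler0 addr0. Qed.

Definition corner_dom A : set E := [set x | op_dom A (x, 0)].

Definition corner_fun A (x : E) : E := (A (x, 0)).1.

Lemma corner_dom0 A : corner_dom A 0.
Proof. exact: op_dom0. Qed.

Lemma corner_domP A (a : R[i]) (x y : E) :
  corner_dom A x -> corner_dom A y -> corner_dom A (a *: x + y).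
Proof.
by move=> Dx Dy; rewrite /corner_dom /= pair0_linear; exact: op_domP.
Qed.

Lemma corner_linear A (a : R[i]) (x y : E) :
  corner_dom A x -> corner_dom A y ->
  corner_fun A (a *: x + y) = a *: corner_fun A x + corner_fun A y.
Proof. by move=> Dx Dy; rewrite /corner_fun pair0_linear op_linear. Qed.

Definition corner_operator A : unbounded_operator E :=
  UnboundedOperator (@corner_dom0 A) (@corner_domP A) (@corner_linear A).

End Product.
End Operators.

(* Main.v *)
From HB Require Import structures.
Require Import Defs.
From mathcomp Require Import all_boot all_order all_algebra.
From mathcomp Require Import complex ring lra.
From mathcomp Require Import all_classical all_reals all_analysis.
Import Order.TTheory GRing.Theory Num.Theory.
Import numFieldNormedType.Exports.
Local Open Scope classical_set_scope.
Local Open Scope complex_scope.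
Local Open Scope ring_scope.

(** If every T(t) of the big semigroup is upper triangular, the difference
    quotients at (x, 0) have vanishing second component. Hence the generator
    maps the part of its domain lying in E x 0 into E x 0, which is (i), and
    the diagonal block is a semigroup whose generator is the corner operator
    ([triangular_generator]). Both generators have a right half plane in their
    resolvent sets ([generator_resolvent]), so a real point far enough to the
    right witnesses (ii).

    Conversely, the resolvent of the big generator at the point lambda of (ii)
    exists, and by (i) it acts on E x 0 as the resolvent of the corner
    operator, so it leaves E x 0 invariant. Along the half line lambda + s,
    s >= 0, which stays in the resolvent set since Re lambda exceeds the
    spectral bound, the resolvent identity makes this invariance a locally
    constant property of s, so it holds for all s ([resolvent_invariant]).
    Finally the implicit Euler scheme expresses T(t) as a limit of products of
    resolvents at points tending to infinity on that half line, so the closed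
    subspace E x 0 is invariant under T(t) as well ([csg_invariant]).

    Most of the work is the resolvent of a generator in a right half plane. A
    semigroup is exponentially bounded (uniform boundedness principle), so
    after multiplication by exp(-l t) with Re l large it becomes bounded, and
    for the equivalent norm sup_t |W(t) x| it consists of contractions W with
    |W(1)| <= 1/2 ([stable_rescaling]). This turns the resolvent at l into the
    inverse of the generator of W. The mean over [0, 1] of an orbit is the
    limit of the dyadic products (1 + W(1/2))/2 ... (1 + W(1/2^n))/2; the
    generator maps this mean of u to W(1) u - u ([mean_right_derivative]), and
    1 - W(1) is inverted by geometric iteration ([contraction_solve]).

    All estimates use real-valued norms p : V -> R on a complex space V and
    are written with explicit epsilons, because several equivalent norms on
    the same space occur. *)

Set Implicit Arguments.
Unset Strict Implicit.
Unset Printing Implicit Defensive.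

(** * Identities between linear combinations of vectors *)

Section LinearIdentities.
Context {K : pzRingType} {V : lmodType K}.

(** The tactic [lmod] below proves identities in a module by comparing the
    coefficient of every atom on both sides, which leaves ring identities
    between scalars. It works by reflection on the following syntax of linear
    expressions. *)
Inductive lexpr :=
  | LAtom of nat | LZero | LAdd of lexpr & lexpr | LOpp of lexpr
  | LScale of K & lexpr.

Fixpoint leval (env : seq V) (e : lexpr) : V :=
  match e with
  | LAtom i => env`_i
  | LZero => 0
  | LAdd e1 e2 => leval env e1 + leval env e2
  | LOpp e1 => - leval env e1
  | LScale a e1 => a *: leval env e1
  end.

Fixpoint lcoef (e : lexpr) (i : nat) : K :=
  match e with
  | LAtom j => if Nat.eqb i j then 1 else 0
  | LZero => 0
  | LAdd e1 e2 => lcoef e1 i + lcoef e2 i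
  | LOpp e1 => - lcoef e1 i
  | LScale a e1 => a * lcoef e1 i
  end.

Lemma levalE env e :
  leval env e = \sum_(i < size env) lcoef e i *: env`_i.
Proof.
elim: e => [j||e1 IH1 e2 IH2|e IH|a e IH] /=.
- have eqbE (i : nat) : Nat.eqb i j = (i == j) by apply/PeanoNat.Nat.eqb_spec/eqP.
  have [jlt|jge] := ltnP j (size env).
    rewrite (bigD1 (Ordinal jlt)) //= eqbE eqxx scale1r big1 ?addr0 // => i.
    by rewrite eqbE -val_eqE /= => /negbTE ->; rewrite scale0r.
  rewrite nth_default // big1 // => i _; rewrite eqbE.
  by rewrite ltn_eqF ?scale0r // (leq_trans (ltn_ord i)).
- by rewrite big1 // => i _; rewrite scale0r.
- by rewrite IH1 IH2 -big_split; apply: eq_bigr => i _; rewrite scalerDl.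
- by rewrite IH -sumrN; apply: eq_bigr => i _; rewrite scaleNr.
- by rewrite IH scaler_sumr; apply: eq_bigr => i _; rewrite scalerA.
Qed.

Fixpoint lagree (e1 e2 : lexpr) (n : nat) : Prop :=
  if n is m.+1 then lagree e1 e2 m /\ lcoef e1 m = lcoef e2 m else True.

Lemma leval_agree env e1 e2 :
  lagree e1 e2 (size env) -> leval env e1 = leval env e2.
Proof.
move=> agree; rewrite !levalE; apply: eq_bigr => -[i /= ilt] _; congr (_ *: _).
elim: (size env) agree ilt => //= n IH [/IH {}IH eqn].
by rewrite ltnS leq_eqVlt => /predU1P[->|/IH].
Qed.

End LinearIdentities.
Arguments LZero {K}.
Arguments LAtom {K}.

(** Atoms are compared up to conversion, since the same vector may be written
    with different canonical structure paths. *)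
Ltac lmod_index x env :=
  match env with
  | ?y :: _ => let _ := match goal with _ => unify x y end in constr:(0%N)
  | _ :: ?env' => let i := lmod_index x env' in constr:(S i)
  end.

Ltac lmod_insert x env :=
  match env with
  | _ => let _ := lmod_index x env in constr:(env)
  | _ => constr:(x :: env)
  end.

Ltac lmod_atoms e env :=
  lazymatch e with
  | 0%R => constr:(env)
  | (?e1 + ?e2)%R =>
      let env1 := lmod_atoms e1 env in lmod_atoms e2 env1
  | (- ?e1)%R => lmod_atoms e1 env
  | (_ *: ?e1)%R => lmod_atoms e1 env
  | _ => lmod_insert e env
  end.

Ltac lmod_reify K e env :=
  lazymatch e with
  | 0%R => constr:(@LZero K)
  | (?e1 + ?e2)%R =>
      let f1 := lmod_reify K e1 env in
      let f2 := lmod_reify K e2 env in constr:(LAdd f1 f2)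
  | (- ?e1)%R => let f1 := lmod_reify K e1 env in constr:(LOpp f1)
  | (?a *: ?e1)%R => let f1 := lmod_reify K e1 env in constr:(LScale (a : K) f1)
  | _ => let i := lmod_index e env in constr:(@LAtom K i)
  end.

Ltac lmod_over K :=
  lazymatch goal with
  | |- @eq ?V ?e1 ?e2 =>
      let env0 := lmod_atoms e1 (@nil V) in
      let env := lmod_atoms e2 env0 in
      let f1 := lmod_reify K e1 env in
      let f2 := lmod_reify K e2 env in
      refine (@leval_agree K _ env f1 f2 _);
      cbn [lagree lcoef size Nat.eqb]; repeat split; try ring
  end.

Ltac lmod :=
  match goal with R : realType |- _ => lmod_over (complex R) end.

(** * Real-valued norms on complex vector spaces *)

Lemma archi_ex {R : realType} (x : R) : exists n : nat, x <= n%:R.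
Proof.
exists (Num.bound `|x|); apply: le_trans (ler_norm x) _.
exact: ltW (archi_boundP (normr_ge0 x)).
Qed.

Lemma invr_small {R : realType} (c e : R) : 0 <= c -> 0 < e ->
  exists N, forall n, (N <= n)%N -> c / n.+1%:R <= e.
Proof.
move=> c0 e0; have [N cN] := archi_ex (c / e); exists N => n Nn.
rewrite ler_pdivrMr ?ltr0Sn// mulrC -ler_pdivrMr//.
by rewrite (le_trans cN)// ler_nat (leq_trans Nn).
Qed.

Lemma half_pow_le {R : realType} (n : nat) : (2^-1 : R) ^+ n <= n.+1%:R^-1.
Proof.
rewrite exprVn lef_pV2 ?posrE ?ltr0Sn ?exprn_gt0//.
by rewrite -natrX ler_nat ltn_expl.
Qed.

(** Reduces to [invr_small] because 2^n exceeds n. *)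
Lemma half_pow_small {R : realType} (c e : R) : 0 <= c -> 0 < e ->
  exists N, forall n, (N <= n)%N -> c * 2^-1 ^+ n <= e.
Proof.
move=> c0 e0; have [N cN] := invr_small c0 e0; exists N => n /cN; apply: le_trans.
by rewrite ler_wpM2l// half_pow_le.
Qed.

Lemma half_pow_gt0 {R : realType} n : 0 < (2^-1 : R) ^+ n.
Proof. by rewrite exprn_gt0// invr_gt0. Qed.

(** Bounds that hold up to c e for all small e: the form in which the limit
    arguments below end. The restriction e <= 1 lets products of errors be
    estimated linearly. *)
Lemma le_small {R : realType} (x y c : R) : 0 <= c ->
  (forall e, 0 < e -> e <= 1 -> x <= y + c * e) -> x <= y.
Proof.
move=> c0 xy; apply/ler_addgt0Pr => e e0.
have m0 : 0 < Num.min 1 (e / (c + 1)).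
  by rewrite lt_min ltr01 divr_gt0// ltr_wpDl.
have /le_trans := xy _ m0 ltac:(by rewrite ge_min lexx); apply; rewrite lerD2l.
apply: (@le_trans _ _ (c * (e / (c + 1)))).
  by rewrite ler_wpM2l// ge_min lexx orbT.
rewrite mulrA ler_pdivrMr ?ltr_wpDl//; nra.
Qed.

(** The norm of [R[i]] is itself complex-valued; [cmod] is the same modulus as
    an element of R, where linear arithmetic applies. *)
Definition cmod {R : realType} (a : R[i]) : R := complex.Re `|a|.

Lemma cmodE {R : realType} (a : R[i]) : `|a| = (cmod a)%:C.
Proof. by rewrite /cmod RRe_real// normr_real. Qed.

Lemma cmod_ge0 {R : realType} (a : R[i]) : 0 <= cmod a.
Proof. by rewrite -lecR -cmodE normr_ge0. Qed.

Lemma cmodM {R : realType} (a b : R[i]) : cmod (a * b) = cmod a * cmod b.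
Proof. by apply: complexI; rewrite rmorphM /= -!cmodE normrM. Qed.

Lemma cmodD {R : realType} (a b : R[i]) : cmod (a + b) <= cmod a + cmod b.
Proof. by rewrite -lecR rmorphD /= -!cmodE ler_normD. Qed.

Lemma cmodR {R : realType} (a : R) : cmod a%:C = `|a|.
Proof. by rewrite /cmod normc_def /= expr0n addr0 sqrtr_sqr. Qed.

Lemma cmodN1 {R : realType} : cmod (-1 : R[i]) = 1.
Proof. by rewrite /cmod normrN1. Qed.

Lemma cmodi {R : realType} : cmod ('i%C : R[i]) = 1.
Proof. by rewrite /cmod normc_def /= expr0n expr1n add0r sqrtr1. Qed.

Record is_norm {R : realType} {V : lmodType R[i]} (p : V -> R) : Prop := IsNorm {
  is_normD : forall x y, p (x + y) <= p x + p y ;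
  is_normZ : forall (a : R[i]) x, p (a *: x) = cmod a * p x ;
  is_norm_eq0 : forall x, p x = 0 -> x = 0 }.

Section NormTheory.
Context {R : realType} {V : lmodType R[i]} {p : V -> R} (pN : is_norm p).

Lemma pnorm0 : p 0 = 0.
Proof. by rewrite -(scale0r 0) is_normZ// /cmod normr0 mul0r. Qed.

Lemma pnormN x : p (- x) = p x.
Proof. by rewrite -scaleN1r is_normZ// cmodN1 mul1r. Qed.

Lemma pnorm_ge0 x : 0 <= p x.
Proof.
by have := is_normD pN x (- x); rewrite subrr pnorm0 pnormN => ?; lra.
Qed.

Lemma pnormC x y : p (x - y) = p (y - x).
Proof. by rewrite -pnormN opprB. Qed.

Lemma pnormB x y : p (x - y) <= p x + p y.
Proof. by rewrite -[p y]pnormN is_normD. Qed.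

Lemma pnormR (r : R) x : 0 <= r -> p (r%:C *: x) = r * p x.
Proof. by move=> r0; rewrite is_normZ// cmodR ger0_norm. Qed.

Lemma pnorm_tri y x z : p (x - z) <= p (x - y) + p (y - z).
Proof. by rewrite -[x - z](subrKA y) is_normD. Qed.

Lemma pnorm_small0 x : (forall e, 0 < e -> p x <= e) -> x = 0.
Proof.
move=> xe; apply: (is_norm_eq0 pN); apply/eqP; rewrite eq_le pnorm_ge0 andbT.
by apply/ler_addgt0Pr => e /xe; rewrite add0r.
Qed.

End NormTheory.

Section Completeness.
Context {R : realType} {V : lmodType R[i]}.

Definition pnorm_cvg (p : V -> R) (u : nat -> V) (l : V) :=
  forall e, 0 < e -> exists N, forall n, (N <= n)%N -> p (u n - l) <= e.

(** The Cauchy condition compares only with the N-th term; by the triangle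
    inequality this is equivalent to the usual condition. *)
Definition pnorm_complete (p : V -> R) := forall u : nat -> V,
  (forall e, 0 < e -> exists N, forall m, p (u (N + m)%N - u N) <= e) ->
  exists l, pnorm_cvg p u l.

(** [right_derivative p W x y] says that x belongs to the domain of the
    generator of W and is mapped to y; multiplied by h, so that no quotient of
    vectors by scalars appears. *)
Definition right_derivative (p : V -> R) (W : R -> V -> V) (x y : V) :=
  forall e, 0 < e -> exists2 d, 0 < d &
    forall h, 0 < h <= d -> p (W h x - x - h%:C *: y) <= e * h.

Record contraction_semigroup (p : V -> R) (W : R -> V -> V) : Prop := {
  csg_linear : forall t, 0 <= t -> linear (W t) ;
  csg0 : forall x, W 0 x = x ;
  csgD : forall s t x, 0 <= s -> 0 <= t -> W (s + t) x = W s (W t x) ;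
  csg_le : forall t x, 0 <= t -> p (W t x) <= p x ;
  csg_cont : forall x e, 0 < e -> exists2 d, 0 < d &
    forall t, 0 <= t <= d -> p (W t x - x) <= e }.

End Completeness.

Section LinearFun.
Context {K : pzRingType} {U V : lmodType K} {f : U -> V} (fl : linear f).
Lemma linear_funD x y : f (x + y) = f x + f y.
Proof. by have := fl 1 x y; rewrite !scale1r. Qed.
Lemma linear_fun0 : f 0 = 0.
Proof. by apply: (addrI (f 0)); rewrite -linear_funD !addr0. Qed.
Lemma linear_funZ a x : f (a *: x) = a *: f x.
Proof. by rewrite -[a *: x]addr0 fl linear_fun0 addr0. Qed.
Lemma linear_funB x y : f (x - y) = f x - f y.
Proof. by rewrite linear_funD -scaleN1r linear_funZ scaleN1r. Qed.
End LinearFun.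

(** Neumann series, run as the iteration u := y + L u from 0. The iterates
    remain in the ball of radius 2 |y| and the distance from the n-th to any
    later one is at most 2 |y| / 2^n. *)
Lemma contraction_solve {R : realType} {V : lmodType R[i]} (p : V -> R)
    (L : V -> V) : is_norm p -> pnorm_complete p -> linear L ->
  (forall x, p (L x) <= 2^-1 * p x) ->
  forall y, exists2 x, x - L x = y & p x <= 2 * p y.
Proof.
move=> pN pC Ll Lle y; pose u n := iter n (fun x => y + L x) 0.
have u2 n : p (u n) <= 2 * p y.
  elim: n => [|n IH] /=; first by rewrite (pnorm0 pN) mulr_ge0// pnorm_ge0.
  rewrite (le_trans (is_normD pN _ _))//; have := Lle (u n); lra.
have udist n m : p (u (n + m)%N - u n) <= (2 * p y) * 2^-1 ^+ n.
  elim: n => [|n IH]; first by rewrite subr0 expr0 mulr1 add0n.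
  rewrite addSn /= opprD addrACA subrr add0r -linear_funB//.
  by rewrite (le_trans (Lle _))// exprS; lra.
have y0 : 0 <= 2 * p y by rewrite mulr_ge0// pnorm_ge0.
have [|x ux] := pC u.
  move=> e e0; have [N Ne] := half_pow_small y0 e0.
  by exists N => m; rewrite (le_trans (udist _ _))// Ne.
exists x.
  apply/eqP; rewrite -subr_eq0; apply/eqP/(pnorm_small0 pN) => e e0.
  have [N uN] := ux _ (divr_gt0 e0 (ltr0n _ 2)).
  have -> : x - L x - y = (u N.+1 - L x - y) - (u N.+1 - x) by lmod.
  rewrite (le_trans (pnormB pN _ _))//=.
  have -> : y + L (u N) - L x - y = L (u N) - L x by lmod.
  rewrite -linear_funB//; have := Lle (u N - x); have := uN N (leqnn _).
  have := uN N.+1 (leqnSn _); rewrite /=; have := pnorm_ge0 pN (u N - x); lra.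
apply: (@le_small _ _ _ 1) => // e e0 _; have [N /(_ _ (leqnn _)) uN] := ux _ e0.
have -> : x = u N - (u N - x) by lmod.
by rewrite (le_trans (pnormB pN _ _))// mul1r lerD.
Qed.

Section Limits.
Context {R : realType} {V : lmodType R[i]} {p : V -> R} (pN : is_norm p).

Lemma pnorm_cvg_unique u l l' : pnorm_cvg p u l -> pnorm_cvg p u l' -> l = l'.
Proof.
move=> ul ul'; apply/eqP; rewrite -subr_eq0; apply/eqP/(pnorm_small0 pN) => e e0.
have e20 : 0 < e / 2 by lra.
have [N uN] := ul _ e20; have [N' uN'] := ul' _ e20.
have := uN _ (leq_maxl N N'); have := uN' _ (leq_maxr N N').
rewrite (pnormC pN) => h1 h2; rewrite (pnormC pN).
by apply: le_trans (pnorm_tri pN (u (maxn N N')) _ _) _; lra.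
Qed.

Lemma pnorm_cvg_lip L u l : linear L -> (forall x, p (L x) <= p x) ->
  pnorm_cvg p u l -> pnorm_cvg p (fun n => L (u n)) (L l).
Proof.
move=> Ll Lle ul e /ul[N uN]; exists N => n /uN; apply: le_trans.
by rewrite -linear_funB.
Qed.

Lemma pnorm_cvg_le u l z c : (forall n, p (u n - z) <= c) -> pnorm_cvg p u l ->
  p (l - z) <= c.
Proof.
move=> uc ul; apply: (@le_small _ _ _ 1) => // e e0 _.
have [N /(_ _ (leqnn _)) uN] := ul _ e0.
apply: le_trans (pnorm_tri pN (u N) _ _) _; rewrite (pnormC pN).
have := uc N; lra.
Qed.

End Limits.

(** * Means of orbits and the inverse of a generator *)

Section Averages.
Context {R : realType} {V : lmodType R[i]} {p : V -> R} (pN : is_norm p).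
Context (pC : pnorm_complete p).
Context {W : R -> V -> V} (WC : contraction_semigroup p W).

(** The averages [avg n t] are Riemann sums with 2^n nodes for the mean of s
    |-> W(s) over [0, t], written as products of n factors (1 + W(t / 2^k)) /
    2. In this form telescoping and refinement are algebraic identities. *)
Definition avg1 (t : R) (x : V) : V := (2^-1)%:C *: (x + W t x).

Fixpoint avg (n : nat) (t : R) (x : V) : V :=
  if n is m.+1 then avg1 (t * 2^-1 ^+ n) (avg m t x) else x.

Lemma dyadic_ge0 (t : R) n : 0 <= t -> 0 <= t * 2^-1 ^+ n.
Proof. by move=> t0; rewrite mulr_ge0// ltW ?half_pow_gt0. Qed.

Lemma csg_comm s t x : 0 <= s -> 0 <= t -> W s (W t x) = W t (W s x).
Proof. by move=> s0 t0; rewrite -!(csgD WC)// addrC. Qed.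

Lemma avg1_linear t : 0 <= t -> linear (avg1 t).
Proof. by move=> t0 a x y; rewrite /avg1 (csg_linear WC)//; lmod. Qed.

Lemma avg_linear n t : 0 <= t -> linear (avg n t).
Proof.
by move=> t0; elim: n => //= n IH a x y; rewrite IH avg1_linear// dyadic_ge0.
Qed.

Lemma avg1_le t x : 0 <= t -> p (avg1 t x) <= p x.
Proof.
move=> t0; rewrite pnormR ?invr_ge0//.
have := is_normD pN x (W t x); have := csg_le WC x t0; lra.
Qed.

Lemma avg_le n t x : 0 <= t -> p (avg n t x) <= p x.
Proof.
move=> t0; elim: n => //= n; apply: le_trans; rewrite avg1_le//.
exact: dyadic_ge0.
Qed.

Lemma avg_csg n s t x : 0 <= s -> 0 <= t -> avg n t (W s x) = W s (avg n t x).
Proof.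
move=> s0 t0; elim: n => //= n ->; rewrite /avg1.
rewrite (linear_funZ (csg_linear WC s0)) (linear_funD (csg_linear WC s0)).
by rewrite csg_comm// dyadic_ge0.
Qed.

Lemma avg_avg1 n s t x : 0 <= s -> 0 <= t ->
  avg n t (avg1 s x) = avg1 s (avg n t x).
Proof.
move=> s0 t0; rewrite /avg1.
by rewrite (linear_funZ (avg_linear n t0)) (linear_funD (avg_linear n t0)) avg_csg.
Qed.

(** Refining the partition: the mean over [0, t] is the 2^n-point average of
    means over intervals of length t / 2^n. *)
Lemma avg_add n m t x : 0 <= t ->
  avg (n + m) t x = avg n t (avg m (t * 2^-1 ^+ n) x).
Proof.
move=> t0; elim: m => [|m IH]; first by rewrite addn0.
rewrite addnS /= IH avg_avg1 ?dyadic_ge0 -?mulrA -?exprD ?addnS ?dyadic_ge0//.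
Qed.

(** An average of the values W(r) x with r <= d is as close to x as these
    values are. The offset s makes the induction on the halving of [0, t] go
    through. *)
Lemma avg_near m d s t x e : 0 <= s -> 0 <= t -> s + t <= d ->
  (forall r, 0 <= r <= d -> p (W r x - x) <= e) ->
  p (avg m t (W s x) - x) <= e.
Proof.
move=> + + + xe; elim: m s t => [|m IH] s t s0 t0 std /=.
  by apply: xe; rewrite s0 (le_trans _ std)// lerDl.
rewrite -[avg1 _ _]/(avg m.+1 t (W s x)) -add1n avg_add//= expr1.
have t20 : 0 <= t * 2^-1 by lra.
rewrite -avg_avg1 ?mulr_ge0//.
set a := avg m _ _.
have -> : a - x = (2^-1)%:C *: ((avg m (t * 2^-1) (W s x) - x) +
    (avg m (t * 2^-1) (W (s + t * 2^-1) x) - x)).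
  rewrite addrC in std.
  rewrite [s + _]addrC (csgD WC)// /a /avg1 (linear_funZ (avg_linear m t20)).
  by rewrite (linear_funD (avg_linear m t20)); lmod; field.
rewrite pnormR ?invr_ge0//.
have h1 := IH s (t * 2^-1) s0 t20 ltac:(lra).
have h2 := IH (s + t * 2^-1) (t * 2^-1) ltac:(lra) t20 ltac:(lra).
by have := is_normD pN (avg m (t * 2^-1) (W s x) - x)
  (avg m (t * 2^-1) (W (s + t * 2^-1) x) - x); lra.
Qed.

(** By [avg_add] the difference of two averages is an average applied to a
    mean over a short interval minus the vector, so strong continuity at 0
    gives the Cauchy property. *)
Lemma avg_cvg t x : 0 <= t -> exists l, pnorm_cvg p (fun n => avg n t x) l.
Proof.
move=> t0; apply: pC => e e0; have [d d0 xd] := csg_cont WC x e0.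
have [N /(_ _ (leqnn _)) Nd] := half_pow_small t0 d0.
exists N => m; rewrite avg_add// -(linear_funB (avg_linear N t0)).
apply: le_trans (avg_le _ _ t0) _; rewrite -[in avg m _ _](csg0 WC x).
by apply: (@avg_near _ d) => //; rewrite ?add0r// dyadic_ge0.
Qed.

(** The mean (1/t) times the integral of W(s) x over [0, t]. For t >= 0 the
    limit exists by [avg_cvg]. *)
Definition mean (t : R) (x : V) : V :=
  xget 0 [set l | pnorm_cvg p (fun n => avg n t x) l].

Lemma meanP t x : 0 <= t -> pnorm_cvg p (fun n => avg n t x) (mean t x).
Proof. by move=> /avg_cvg -/(_ x)[l xl]; exact: (xgetI 0 xl). Qed.

Lemma mean_le t x : 0 <= t -> p (mean t x) <= p x.
Proof.
move=> t0; rewrite -[mean t x]subr0; apply: (pnorm_cvg_le pN _ (meanP x t0)).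
by move=> n; rewrite subr0 avg_le.
Qed.

Lemma mean_near t x e : 0 <= t ->
  (forall r, 0 <= r <= t -> p (W r x - x) <= e) -> p (mean t x - x) <= e.
Proof.
move=> t0 xe; apply: (pnorm_cvg_le pN _ (meanP x t0)) => n.
by rewrite -[in avg n _ _](csg0 WC x); apply: (@avg_near _ t); rewrite ?add0r.
Qed.

Lemma mean_avg n t x : 0 <= t -> mean t x = avg n t (mean (t * 2^-1 ^+ n) x).
Proof.
move=> t0; apply: (pnorm_cvg_unique pN (u := fun m => avg (n + m) t x)).
  move=> e e0; have [N xN] := meanP x t0 e0; exists N => m Nm.
  by rewrite xN// (leq_trans Nm)// leq_addl.
have := pnorm_cvg_lip (avg_linear n t0) (fun y => avg_le n y t0)
  (meanP x (dyadic_ge0 n t0)).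
by congr pnorm_cvg; apply/funext => m; rewrite avg_add.
Qed.

(** The product (W(h) - 1) (1 + W(h)) = W(2h) - 1, applied n times. *)
Lemma avg_telescope n t x : 0 <= t ->
  W (t * 2^-1 ^+ n) (avg n t x) - avg n t x = (2^-1 ^+ n)%:C *: (W t x - x).
Proof.
move=> t0; elim: n => [|n IH]; first by rewrite expr0 mulr1 /=; lmod.
rewrite /= /avg1; set s := t * 2^-1 ^+ n.+1; set y := avg n t x in IH *.
have s0 : 0 <= s by exact: dyadic_ge0.
rewrite (linear_funZ (csg_linear WC s0)) (linear_funD (csg_linear WC s0)).
rewrite -(csgD WC)//; have -> : s + s = t * 2^-1 ^+ n by rewrite /s exprS; lra.
rewrite exprS rmorphM /= -scalerA -IH; lmod.
Qed.

(** Convergence of the difference quotients along one null sequence h_n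
    suffices. For s fixed, W(s) z - z is nearly the telescoping sum of W(j
    h_n) (W(h_n) z - z) with j h_n < s, and each term is close to h_n W(j h_n)
    w, hence to h_n w when s is small. For means of orbits it thus suffices to
    take dyadic steps. *)
Lemma sequential_right_derivative z w (h : nat -> R) :
  (forall n, 0 < h n) ->
  (forall d, 0 < d -> exists N, forall n, (N <= n)%N -> h n <= d) ->
  (forall e, 0 < e -> exists N, forall n, (N <= n)%N ->
     p (W (h n) z - z - (h n)%:C *: w) <= e * h n) ->
  right_derivative p W z w.
Proof.
move=> h0 hcvg0 zw e e0; have [d d0 wd] := csg_cont WC w e0; exists d => //.
(* The estimate at the multiples of h_n, by telescoping. *)
have steps (n k : nat) eta : p (W (h n) z - z - (h n)%:C *: w) <= eta * h n ->
    k%:R * h n <= d ->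
    p (W (k%:R * h n) z - z - (k%:R * h n)%:C *: w) <= (e + eta) * (k%:R * h n).
  move=> hn; have hn0 := ltW (h0 n); elim: k => [_|k IH kd].
    rewrite mul0r (csg0 WC) (_ : _ - _ = 0) ?(pnorm0 pN) ?mulr0//.
    by rewrite subrr sub0r scale0r oppr0.
  have kh0 : 0 <= k%:R * h n by rewrite mulr_ge0.
  have khd : k%:R * h n <= d by move: kd; rewrite -natr1; lra.
  have -> : k.+1%:R * h n = k%:R * h n + h n by rewrite -natr1; ring.
  rewrite (csgD WC)//; set a := k%:R * h n in khd kh0 IH *.
  have -> : W a (W (h n) z) - z - (a + h n)%:C *: w =
     W a (W (h n) z - z - (h n)%:C *: w) +
     ((W a z - z - a%:C *: w) + (h n)%:C *: (W a w - w)).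
    have al := csg_linear WC kh0.
    by rewrite !(linear_funB al) !(linear_funZ al); lmod.
  apply: le_trans (is_normD pN _ _) _.
  have := csg_le WC (W (h n) z - z - (h n)%:C *: w) kh0.
  have := is_normD pN (W a z - z - a%:C *: w) ((h n)%:C *: (W a w - w)).
  rewrite [p (_ *: (W a w - w))]pnormR//.
  have := wd a; rewrite kh0 khd => /(_ isT); have := IH khd; nra.
move=> s /andP[s0 sd].
apply: (@le_small _ _ _ (s + 1 + p w)) => [|eta eta0 eta1].
  by have := pnorm_ge0 pN w; lra.
(* A general s is replaced by the largest multiple of h_n below it; the
   error tends to 0 with h_n, while s stays fixed. *)
have [d' d'0 zd'] := csg_cont WC z eta0.
have m0 : 0 < Num.min d' eta by rewrite lt_min d'0.
have [N1 hN1] := hcvg0 _ m0; have [N2 zN2] := zw _ eta0.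
pose n := maxn N1 N2; have := hN1 n (leq_maxl _ _); rewrite le_min => /andP[hd he].
have hn0 := h0 n.
pose k := Num.truncn (s / h n).
have /andP[ks sk] : (k%:R <= s / h n < k.+1%:R).
  by apply: truncn_itv; rewrite divr_ge0// ltW.
rewrite ler_pdivlMr// in ks; rewrite ltr_pdivrMr// -natr1 in sk.
have := steps n k eta (zN2 n (leq_maxr _ _)) ltac:(lra).
set a := k%:R * h n in ks sk *; have a0 : 0 <= a by rewrite mulr_ge0// ltW.
have sa0 : 0 <= s - a by lra.
have := zd' (s - a); rewrite sa0 => /(_ ltac:(rewrite /a in ks sk *; lra)) zsa steps_a.
have -> : W s z - z - s%:C *: w = W a (W (s - a) z - z) +
    ((W a z - z - a%:C *: w) - (s - a)%:C *: w).
  have al := csg_linear WC a0.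
  by rewrite !(linear_funB al) -(csgD WC)// subrKC; lmod.
apply: le_trans (is_normD pN _ _) _.
have := csg_le WC (W (s - a) z - z) a0.
have := pnormB pN (W a z - z - a%:C *: w) ((s - a)%:C *: w).
rewrite [p (_ *: w)]pnormR//; have sah : s - a <= eta by rewrite /a in sk *; lra.
have := pnorm_ge0 pN w; nra.
Qed.

(** The generator maps the mean over [0, t] of the orbit of x to (W(t) x - x)
    / t. For the step h = t / 2^n, [mean_avg] and [avg_telescope] turn the
    difference quotient into that value at the mean over [0, h], which tends
    to x. *)
Lemma mean_right_derivative t x : 0 < t ->
  right_derivative p W (mean t x) (t^-1%:C *: (W t x - x)).
Proof.
move=> t0; have tge0 := ltW t0.
apply: (sequential_right_derivative (h := fun n => t * 2^-1 ^+ n)).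
- by move=> n; rewrite mulr_gt0// half_pow_gt0.
- by move=> d; exact: half_pow_small.
move=> e e0; have e0t : 0 < e * t / 2 by rewrite divr_gt0// mulr_gt0.
have [d d0 xd] := csg_cont WC x e0t.
have [N Nd] := half_pow_small tge0 d0; exists N => n Nn.
have hn0 := dyadic_ge0 n tge0; have q0 := @half_pow_gt0 R n.
rewrite {1 2}(mean_avg n x tge0) avg_telescope//.
set q := 2^-1 ^+ n in hn0 q0 *; set m := mean _ x.
have -> : q%:C *: (W t m - m) - (t * q)%:C *: (t^-1%:C *: (W t x - x)) =
   q%:C *: (W t (m - x) - (m - x)).
  rewrite (linear_funB (csg_linear WC tge0)) rmorphM /= !scalerA.
  have -> : t%:C * q%:C * t^-1%:C = q%:C.
    by rewrite -!rmorphM /=; congr _%:C; field; rewrite gt_eqF.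
  by lmod.
rewrite pnormR ?(ltW q0)//; have mx : p (m - x) <= e * t / 2.
  apply: mean_near => // r /andP[r0 rq]; apply: xd; rewrite r0.
  exact: le_trans rq (Nd n Nn).
have := pnormB pN (W t (m - x)) (m - x); have := csg_le WC (m - x) tge0.
have -> : e * (t * q) = q * (e * t) by ring.
move=> h1 h2; apply: ler_wpM2l; [exact: ltW|lra].
Qed.

(** Orbits with zero derivative at 0 are constant: telescope over k steps of
    length 1 / k. *)
Lemma right_derivative0_fixed z : right_derivative p W z 0 -> W 1 z = z.
Proof.
move=> z0; apply/eqP; rewrite -subr_eq0; apply/eqP/(pnorm_small0 pN) => e e0.
have [d d0 zd] := z0 e e0; have [N /(_ _ (leqnn _)) Nd] := invr_small ler01 d0.
have h0 : 0 < N.+1%:R^-1 :> R by rewrite invr_gt0 ltr0Sn.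
have := zd N.+1%:R^-1; rewrite h0 -div1r Nd => /(_ isT); rewrite scaler0 subr0.
rewrite div1r; set h := N.+1%:R^-1 in h0 *; move=> zh.
have steps k : p (W (k%:R * h) z - z) <= e * (k%:R * h).
  elim: k => [|k IH]; first by rewrite mul0r (csg0 WC) subrr (pnorm0 pN) mulr0.
  have kh0 : 0 <= k%:R * h by rewrite mulr_ge0// ltW.
  have -> : k.+1%:R * h = k%:R * h + h by rewrite -natr1; ring.
  rewrite (csgD WC) ?(ltW h0)//.
  have -> : W (k%:R * h) (W h z) - z =
      W (k%:R * h) (W h z - z) + (W (k%:R * h) z - z).
    by rewrite (linear_funB (csg_linear WC kh0)); lmod.
  apply: le_trans (is_normD pN _ _) _.
  have := csg_le WC (W h z - z) kh0; lra.
by have := steps N.+1; rewrite divff ?mulr1// pnatr_eq0.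
Qed.

(** The generator is onto: it maps the mean over [0, 1] of the orbit of u to
    W(1) u - u, and u - W(1) u = y can be solved for u. *)
Lemma csg_resolvent0 : (forall x, p (W 1 x) <= 2^-1 * p x) ->
  forall y, exists2 x, right_derivative p W x (- y) & p x <= 2 * p y.
Proof.
move=> W1 y.
have [u uy uyle] := contraction_solve pN pC (csg_linear WC ler01) W1 y.
exists (mean 1 u); last exact: le_trans (mean_le _ ler01) _.
have := mean_right_derivative u ltr01; congr right_derivative.
by rewrite invr1 scale1r -uy opprB.
Qed.

Lemma csg_injective0 : (forall x, p (W 1 x) <= 2^-1 * p x) ->
  forall z, right_derivative p W z 0 -> z = 0.
Proof.
move=> W1 z /right_derivative0_fixed zz; apply: (is_norm_eq0 pN).
have := W1 z; rewrite zz; have := pnorm_ge0 pN z; lra.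
Qed.

End Averages.

(** * Uniform boundedness, growth and renorming *)

Record bounded_semigroup {R : realType} {V : lmodType R[i]} (q : V -> R)
    (W : R -> V -> V) : Prop := {
  bsg_linear : forall t, 0 <= t -> linear (W t) ;
  bsg_bounded : forall t, 0 <= t -> exists C, forall x, q (W t x) <= C * q x ;
  bsg0 : forall x, W 0 x = x ;
  bsgD : forall s t x, 0 <= s -> 0 <= t -> W (s + t) x = W s (W t x) ;
  bsg_cont : forall x e, 0 < e -> exists2 d, 0 < d &
    forall t, 0 <= t <= d -> q (W t x - x) <= e }.

Section UniformBoundedness.
Context {R : realType} {V : lmodType R[i]} {q : V -> R} (qN : is_norm q).
Context (qC : pnorm_complete q).
Context {L : nat -> V -> V} (Ll : forall n, linear (L n)).
Context (Lb : forall n, exists C, forall x, q (L n x) <= C * q x).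

(** If the operators are not uniformly bounded, each ball contains a smaller
    ball on which one of them is large. The point is x + z or x - z for a
    short z on which L_n is large, as L_n z is half the difference of the
    values there. *)
Lemma large_on_subball : ~ (exists M, forall n x, q (L n x) <= M * q x) ->
  forall (k : nat) (x : V) (r : R), 0 < r ->
  exists s : V * R, [/\ 0 < s.2, s.2 <= r * 2^-1, q (s.1 - x) + s.2 <= r &
    exists n, forall z, q (z - s.1) <= s.2 -> k%:R <= q (L n z)].
Proof.
move=> nub k x r r0; pose M := k.+1%:R * (2 / r).
have [n [y Ly]] : exists n y, M * q y < q (L n y).
  apply: contrapT => nLy; apply: nub; exists M => n y.
  by rewrite leNgt; apply/negP => h; apply: nLy; exists n, y.
have qy0 : 0 < q y.
  rewrite lt_neqAle pnorm_ge0// andbT eq_sym; apply/eqP => /(is_norm_eq0 qN) y0.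
  by move: Ly; rewrite y0 (linear_fun0 (Ll n)) (pnorm0 qN) mulr0 ltxx.
pose a := r / 2 / q y; pose z := a%:C *: y.
have a0 : 0 < a by rewrite !divr_gt0.
have qz : q z = r / 2 by rewrite pnormR ?ltW// /a divfK// gt_eqF.
have Lz : k.+1%:R <= q (L n z).
  rewrite (linear_funZ (Ll n)) (pnormR qN _ (ltW a0)).
  have -> : k.+1%:R = a * (M * q y).
    by rewrite /a /M; field; rewrite !gt_eqF.
  by rewrite ler_pM2l// ltW.
have [C Cle] := Lb n.
have [w qwx Lw] : exists2 w, q (w - x) = r / 2 & k.+1%:R <= q (L n w).
  have [big|small] := lerP k.+1%:R (q (L n (x + z))).
    by exists (x + z); rewrite // addrC addKr.
  exists (x - z); first by rewrite addrC addKr (pnormN qN).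
  have e : L n z + L n z = L n (x + z) - L n (x - z).
    by rewrite (linear_funD (Ll n)) (linear_funB (Ll n)); lmod.
  have := pnormB qN (L n (x + z)) (L n (x - z)); rewrite -e.
  have -> : L n z + L n z = 2%:C *: L n z by lmod.
  by rewrite pnormR//; lra.
pose C' := `|C| + 1; have C0 : 0 < C' by rewrite ltr_wpDl.
exists (w, Num.min (r / 2) C'^-1) => /=; split.
- by rewrite lt_min divr_gt0//= invr_gt0.
- by rewrite ge_min lexx.
- have : Num.min (r / 2) C'^-1 <= r / 2 by rewrite ge_min lexx.
  by rewrite qwx; lra.
exists n => v; rewrite le_min => /andP[_ vw].
have : C' * q (v - w) <= 1 by rewrite mulrC -ler_pdivlMr// div1r.
have := Cle (v - w); rewrite (linear_funB (Ll n)).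
have := is_normD qN (L n v) (- (L n v - L n w)).
have -> : L n v - (L n v - L n w) = L n w by lmod.
rewrite (pnormN qN); move: Lw; rewrite -natr1 /C'.
have := pnorm_ge0 qN (v - w); have := ler_norm C; nra.
Qed.

(** Nested balls from [large_on_subball] shrink to a point at which the
    operators are unbounded. *)
Lemma uniform_boundedness :
  (forall x, exists C, forall n, q (L n x) <= C) ->
  exists M, forall n x, q (L n x) <= M * q x.
Proof.
move=> pb; apply: contrapT => /large_on_subball step.
(* A state is the centre and the radius of a ball, together with the bound
   required in the next one. The radii are only controlled while they are
   positive. *)
have [f fP] : {f : nat * (V * R) -> V * R & forall a, 0 < a.2.2 ->
    [/\ 0 < (f a).2, (f a).2 <= a.2.2 * 2^-1, q ((f a).1 - a.2.1) + (f a).2 <= a.2.2 &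
    exists n, forall z, q (z - (f a).1) <= (f a).2 -> a.1%:R <= q (L n z)]}.
  apply: (@choice _ _ (fun a s => 0 < a.2.2 -> [/\ 0 < s.2, s.2 <= a.2.2 * 2^-1,
    q (s.1 - a.2.1) + s.2 <= a.2.2 &
    exists n, forall z, q (z - s.1) <= s.2 -> a.1%:R <= q (L n z)])) => -[k [x r]] /=.
  have [r0|nr0] := pselect (0 < r); last by exists (0, 0) => /nr0.
  by have [s sP] := step k x r r0; exists s.
pose s := fix s n := if n is m.+1 then f (m, s m) else (0 : V, 1 : R).
have s0 n : 0 < (s n).2 by elim: n => [|n IH] //=; have [] := fP (n, s n) IH.
have shalf n : (s n).2 <= 2^-1 ^+ n.
  elim: n => [|n IH] /=; first by rewrite expr0.
  by have [_ h _ _] := fP (n, s n) (s0 n); rewrite (le_trans h)// exprS/=; lra.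
have sdist n m : q ((s (n + m)%N).1 - (s n).1) + (s (n + m)%N).2 <= (s n).2.
  elim: m => [|m IH]; first by rewrite addn0 subrr (pnorm0 qN) add0r.
  rewrite addnS /=; have [_ _ h _] := fP ((n + m)%N, s (n + m)%N) (s0 _).
  have := pnorm_tri qN (s (n + m)%N).1 (f ((n + m)%N, s (n + m)%N)).1 (s n).1.
  by move: h => /=; lra.
have sdist' n m : q ((s (n + m)%N).1 - (s n).1) <= (s n).2.
  by have := sdist n m; have := s0 (n + m)%N; lra.
have [|l sl] := qC (u := fun n => (s n).1).
  move=> e e0; have [N /(_ _ (leqnn _)) Ne] := half_pow_small ler01 e0.
  exists N => m; apply: le_trans (sdist' _ _) (le_trans (shalf _) _).
  by move: Ne; rewrite mul1r.
have [C LC] := pb l; have [k kC] := archi_ex (C + 1).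
have [_ _ _ [n nk]] := fP (k, s k) (s0 k).
have : k%:R <= q (L n l).
  apply: nk; rewrite -[f (k, s k)]/(s k.+1).
  apply: (pnorm_cvg_le qN (sdist' k.+1)).
  move=> e e0; have [N xN] := sl _ e0; exists N => m Nm.
  by rewrite xN// (leq_trans Nm)// leq_addl.
by have := LC n; lra.
Qed.

End UniformBoundedness.

Section Growth.
Context {R : realType} {V : lmodType R[i]} {q : V -> R} (qN : is_norm q).
Context (qC : pnorm_complete q).
Context {W : R -> V -> V} (WB : bounded_semigroup q W).

(** Otherwise there are t_n -> 0 with |W(t_n)| > n, although W(t_n) x
    converges for each x. *)
Lemma bsg_local_bound : exists2 d, 0 < d & exists2 M, 1 <= M &
  forall t x, 0 <= t <= d -> q (W t x) <= M * q x.
Proof.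
apply: contrapT => nb.
have [t tP] : {t : nat -> R & forall n, 0 <= t n <= n.+1%:R^-1 /\
    exists x, n.+1%:R * q x < q (W (t n) x)}.
  apply: (@choice _ _ (fun n t => 0 <= t <= n.+1%:R^-1 /\
    exists x, n.+1%:R * q x < q (W t x))) => n.
  apply: contrapT => nt; apply: nb; exists n.+1%:R^-1; first by rewrite invr_gt0.
  exists n.+1%:R; first by rewrite ler1n.
  move=> t x tn; rewrite leNgt; apply/negP => Wt; apply: nt; exists t.
  by split => //; exists x.
have t0 n : 0 <= t n by have [/andP[]] := tP n.
have [M WM] : exists M, forall n x, q (W (t n) x) <= M * q x.
  apply: (uniform_boundedness qN qC (L := fun n => W (t n))).
  - by move=> n; exact: bsg_linear WB _ (t0 n).
  - by move=> n; exact: bsg_bounded WB _ (t0 n).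
  move=> x; have [d d0 xd] := bsg_cont WB x ltr01.
  have [N Nd] := invr_small ler01 d0.
  exists (\sum_(n < N) q (W (t n) x) + (q x + 1)) => n.
  have s0 : 0 <= \sum_(n < N) q (W (t n) x).
    by apply: sumr_ge0 => i _; exact: pnorm_ge0.
  have [Nn|nN] := leqP N n.
    have /xd : 0 <= t n <= d.
      rewrite t0/=; have [/andP[_ tn] _] := tP n; apply: le_trans tn _.
      by have := Nd n Nn; rewrite div1r.
    have := is_normD qN (W (t n) x - x) x; rewrite subrK; lra.
  rewrite (bigD1 (Ordinal nN))//=.
  have : 0 <= \sum_(i < N | i != Ordinal nN) q (W (t i) x).
    by apply: sumr_ge0 => i _; exact: pnorm_ge0.
  by have := pnorm_ge0 qN x; lra.
have [n Mn] := archi_ex M; have [_ [x]] := tP n.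
have := WM n x; have := pnorm_ge0 qN x; rewrite -natr1; nra.
Qed.

(** With |W(t)| <= M on [0, d], each further step of length d costs a factor
    M, which is at most exp(w d) for w = M / d. *)
Lemma bsg_growth : exists2 M, 1 <= M & exists2 w, 0 <= w &
  forall t x, 0 <= t -> q (W t x) <= M * expR (w * t) * q x.
Proof.
have [d d0 [M M1 WM]] := bsg_local_bound; exists M => //; exists (M / d).
  by rewrite divr_ge0//; lra.
have Mexp : M <= expR (M / d * d).
  by rewrite divfK ?gt_eqF// (le_trans _ (expR_ge1Dx M))// lerDr.
have bnd n : forall t x, 0 <= t -> t <= n.+1%:R * d ->
    q (W t x) <= M * expR (M / d * t) * q x.
  elim: n => [|n IH] t x t0; rewrite -?natr1 ?add0r ?mul1r => tn.
    rewrite (le_trans (WM t x _)) ?t0// ler_wpM2r ?pnorm_ge0// ler_peMr//; first lra.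
    by rewrite -expR0 ler_expR mulr_ge0// divr_ge0//; lra.
  have [td|dt] := lerP t d.
    rewrite (le_trans (WM t x _)) ?t0// ler_wpM2r ?pnorm_ge0// ler_peMr//; first lra.
    by rewrite -expR0 ler_expR mulr_ge0// divr_ge0//; lra.
  have -> : W t x = W d (W (t - d) x).
    by rewrite -(bsgD WB) ?subr_ge0 ?(ltW d0) ?(ltW dt)// addrC subrK.
  rewrite (le_trans (WM d _ _)) ?(ltW d0) ?lexx//.
  have h1 := IH (t - d) x ltac:(lra) ltac:(lra).
  have -> : M / d * t = M / d * d + M / d * (t - d) by ring.
  rewrite expRD; set E := expR (M / d * d) in Mexp *.
  set G := expR _ in h1 *; have G0 : 0 <= G by exact: expR_ge0.
  have q0 := pnorm_ge0 qN x.
  apply: (@le_trans _ _ (M * (M * G * q x))); first by rewrite ler_wpM2l//; lra.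
  have -> : M * (E * G) * q x = E * (M * G * q x) by ring.
  by rewrite ler_wpM2r// !mulr_ge0//; lra.
move=> t x t0; have [n tn] := archi_ex (t / d); apply: (bnd n) => //.
rewrite ler_pdivrMr// in tn; rewrite (le_trans tn)// ler_wpM2r ?(ltW d0)//.
by rewrite ler_nat.
Qed.

End Growth.

Section Renorming.
Context {R : realType} {V : lmodType R[i]} {q : V -> R} (qN : is_norm q).
Context (qC : pnorm_complete q).
Context {W : R -> V -> V} (WB : bounded_semigroup q W).
Context {M : R} (WM : forall t x, 0 <= t -> q (W t x) <= M * q x).

(** For a bounded semigroup this norm is equivalent to q, and W consists of
    contractions for it because shifting time only removes part of the orbit.
    *)
Definition orbit_norm (x : V) : R :=
  sup [set y | exists2 t, 0 <= t & y = q (W t x)].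

Lemma orbit_norm_has_sup x : has_sup [set y | exists2 t, 0 <= t & y = q (W t x)].
Proof.
split; first by exists (q (W 0 x)); exists 0.
by exists (M * q x) => _ [t t0 ->]; exact: WM.
Qed.

Lemma orbit_norm_ub t x : 0 <= t -> q (W t x) <= orbit_norm x.
Proof. by move=> t0; apply: (sup_upper_bound (orbit_norm_has_sup x)); exists t. Qed.

Lemma orbit_norm_le x c : (forall t, 0 <= t -> q (W t x) <= c) -> orbit_norm x <= c.
Proof.
move=> xc; apply: ge_sup; first by exists (q (W 0 x)); exists 0.
by move=> _ [t t0 ->]; exact: xc.
Qed.

Lemma le_orbit_norm x : q x <= orbit_norm x.
Proof. by rewrite -{1}(bsg0 WB x) orbit_norm_ub. Qed.

Lemma orbit_norm_le_mul x : orbit_norm x <= M * q x.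
Proof. by apply: orbit_norm_le => t; exact: WM. Qed.

Lemma orbit_norm_is_norm : is_norm orbit_norm.
Proof.
split => [x y|a x|x x0].
- apply: orbit_norm_le => t t0; rewrite (linear_funD (bsg_linear WB t0)).
  by rewrite (le_trans (is_normD qN _ _))// lerD// orbit_norm_ub.
- have ge (b : R[i]) y : cmod b * orbit_norm y <= orbit_norm (b *: y).
    have [b0|b0] := eqVneq (cmod b) 0.
      by rewrite b0 mul0r; exact: le_trans (pnorm_ge0 qN _) (le_orbit_norm (b *: y)).
    have bgt0 : 0 < cmod b by rewrite lt_neqAle eq_sym b0 cmod_ge0.
    rewrite mulrC -ler_pdivlMr//; apply: orbit_norm_le => t t0.
    rewrite ler_pdivlMr// mulrC -is_normZ// -(linear_funZ (bsg_linear WB t0)).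
    exact: orbit_norm_ub.
  apply/eqP; rewrite eq_le ge andbT; apply: orbit_norm_le => t t0.
  rewrite (linear_funZ (bsg_linear WB t0)) is_normZ//.
  by rewrite ler_wpM2l ?cmod_ge0 ?orbit_norm_ub.
- apply: (is_norm_eq0 qN); apply/eqP; rewrite eq_le pnorm_ge0// andbT.
  by rewrite -x0 le_orbit_norm.
Qed.

Lemma pnorm_complete_equiv (p : V -> R) : (forall x, q x <= p x) ->
  (forall x, p x <= M * q x) -> pnorm_complete p.
Proof.
move=> qp pq u uC; have M1 : 0 < `|M| + 1 by rewrite ltr_wpDl.
have [|l ul] := qC (u := u).
  by move=> e /uC[N Ne]; exists N => m; exact: le_trans (qp _) (Ne m).
exists l => e e0; have [N Ne] := ul _ (divr_gt0 e0 M1); exists N => n /Ne.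
rewrite ler_pdivlMr// => h; apply: le_trans (pq _) (le_trans _ h).
have := pnorm_ge0 qN (u n - l); have := ler_norm M; nra.
Qed.

Lemma orbit_norm_contraction : contraction_semigroup orbit_norm W.
Proof.
split => [t t0||s t x s0 t0|t x t0|x e e0].
- exact: bsg_linear WB t t0.
- exact: bsg0 WB.
- exact: bsgD WB s t x s0 t0.
- apply: orbit_norm_le => s s0; rewrite -(bsgD WB)//.
  by rewrite orbit_norm_ub// addr_ge0.
- have M1 : 0 < `|M| + 1 by rewrite ltr_wpDl.
  have [d d0 xd] := bsg_cont WB x (divr_gt0 e0 M1); exists d => // t /xd.
  rewrite ler_pdivlMr// => h; apply: le_trans (orbit_norm_le_mul _) (le_trans _ h).
  have := pnorm_ge0 qN (W t x - x); have := ler_norm M; nra.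
Qed.

End Renorming.

(** * Rescaling by complex exponentials *)

(** The function exp(- l t) of real t, for complex l, in terms of real
    functions. *)
Definition cexp {R : realType} (l : R[i]) (t : R) : R[i] :=
  (expR (- (complex.Re l * t)))%:C *
  ((cos (complex.Im l * t))%:C - 'i%C * (sin (complex.Im l * t))%:C).

Section ComplexExponential.
Context {R : realType}.

Lemma cexp0 (l : R[i]) : cexp l 0 = 1.
Proof. by rewrite /cexp !mulr0 oppr0 expR0 cos0 sin0 mulr0 subr0 mulr1. Qed.

Lemma cexpD (l : R[i]) s t : cexp l (s + t) = cexp l s * cexp l t.
Proof.
rewrite /cexp !mulrDr opprD expRD cosD sinD !rmorphM !rmorphB !rmorphD !rmorphM /=.
set a := (cos _)%:C; set b := (cos _)%:C; set c := (sin _)%:C; set d := (sin _)%:C.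
set E := (expR _)%:C; set G := (expR _)%:C.
apply/eqP; rewrite -subr_eq0; apply/eqP.
transitivity (- (E * G * c * d * ('i%C ^+ 2 + 1))); first by ring.
by rewrite sqr_i addNr mulr0 oppr0.
Qed.

Lemma cmod_cexp (l : R[i]) t : cmod (cexp l t) = expR (- (complex.Re l * t)).
Proof.
rewrite /cexp cmodM cmodR ger0_norm ?expR_ge0// -[RHS]mulr1; congr (_ * _).
set x := _ * t; apply: complexI; rewrite -cmodE normc_def.
have -> : (cos x)%:C - 'i%C * (sin x)%:C = (cos x +i* - sin x)%C.
  by apply/eqP; rewrite eq_complex /=; apply/andP; split; apply/eqP; ring.
by rewrite /= sqrrN cos2Dsin2 sqrtr1.
Qed.

Lemma is_derive_right (f : R -> R) (a : R) : is_derive (0 : R) 1 f a ->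
  forall e, 0 < e -> exists2 d, 0 < d &
    forall h, 0 < h <= d -> `|f h - f 0 - h * a| <= e * h.
Proof.
move=> fa e e0; have [df fE] := fa.
have : h^-1 *: (f (h *: 1 + 0) - f 0) @[h --> 0^'] --> a.
  by move: df; rewrite -fE => /cvg_toP /(_ erefl).
move=> /cvgrPdist_le /(_ e e0) [d /= d0 fd]; exists (d / 2); first by rewrite divr_gt0.
move=> h /andP[h0 hd].
have := fd h; rewrite /ball_ /= sub0r normrN gtr0_norm// => /(_ ltac:(lra)).
rewrite gt_eqF// => /(_ isT).
have -> : (h *: (1 : R) + 0) = h by rewrite addr0 /GRing.scale /= mulr1.
have -> : f h - f 0 - h * a = - (h * (a - h^-1 *: (f h - f 0))).
  by rewrite /GRing.scale /=; field; rewrite gt_eqF.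
by rewrite normrN normrM gtr0_norm// [e * h]mulrC ler_pM2l.
Qed.

(** The real and imaginary parts are real functions of h with derivatives - Re
    l and - Im l at 0. *)
Lemma cexp_right_derivative (l : R[i]) e : 0 < e -> exists2 d, 0 < d &
  forall h, 0 <= h <= d -> cmod (cexp l h - 1 + h%:C * l) <= e * h.
Proof.
move=> e0; set a := complex.Re l; set b := complex.Im l.
pose f h := expR (- (a * h)) * cos (b * h); pose g h := expR (- (a * h)) * sin (b * h).
have fd : is_derive (0 : R) 1 f (- a).
  apply: is_derive_eq; rewrite !mulr0 oppr0 expR0 cos0 sin0 /GRing.scale /=.
  by ring.
have gd : is_derive (0 : R) 1 g b.
  apply: is_derive_eq; rewrite !mulr0 oppr0 expR0 cos0 sin0 /GRing.scale /=.
  by ring.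
have e20 : 0 < e / 2 by rewrite divr_gt0.
have [d1 d10 fd1] := is_derive_right fd e20; have [d2 d20 gd2] := is_derive_right gd e20.
exists (Num.min d1 d2); first by rewrite lt_min d10.
move=> h /andP[]; rewrite le_eqVlt => /predU1P[<- _|h0].
  by rewrite cexp0 subrr mul0r add0r mulr0 cmodR normr0.
rewrite le_min => /andP[h1 h2].
have := fd1 h; have := gd2 h; rewrite h0 h1 h2 => /(_ isT) gh /(_ isT) fh.
have -> : cexp l h - 1 + h%:C * l =
    (f h - f 0 - h * - a)%:C - 'i%C * (g h - g 0 - h * b)%:C.
  rewrite /f /g /cexp !mulr0 oppr0 expR0 cos0 sin0 -/a -/b [l in _ + _ * l]complexE -/a -/b.
  by rewrite !rmorphB !rmorphM /= rmorphN /= rmorph0 rmorph1; ring.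
have tri (u v : R) : cmod (u%:C - 'i%C * v%:C) <= `|u| + `|v|.
  apply: le_trans (cmodD _ _) _.
  by rewrite -['i%C * _]mul1r -mulNr !cmodM cmodN1 cmodi !mul1r !cmodR.
by apply: le_trans (tri _ _) _; lra.
Qed.

Lemma cexp_cont (l : R[i]) e : 0 < e -> exists2 d, 0 < d &
  forall h, 0 <= h <= d -> cmod (cexp l h - 1) <= e.
Proof.
move=> e0; have [d d0 ld] := cexp_right_derivative l ltr01.
have l1 : 0 < 1 + cmod l by rewrite ltr_wpDr ?cmod_ge0.
exists (Num.min d (e / (1 + cmod l))); first by rewrite lt_min d0 divr_gt0.
move=> h /andP[h0]; rewrite le_min ler_pdivlMr// => /andP[hd he].
have -> : cexp l h - 1 = (cexp l h - 1 + h%:C * l) + (- h)%:C * l.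
  by rewrite rmorphN /=; ring.
apply: le_trans (cmodD _ _) _; rewrite cmodM cmodR normrN ger0_norm//.
by have := ld h; rewrite h0 hd => /(_ isT); lra.
Qed.

End ComplexExponential.

Section Rescaling.
Context {R : realType} {V : lmodType R[i]} {q : V -> R} (qN : is_norm q).
Implicit Types W : R -> V -> V.

Definition rescale (l : R[i]) W : R -> V -> V := fun t x => cexp l t *: W t x.

Lemma rescale_bsg l W : bounded_semigroup q W -> bounded_semigroup q (rescale l W).
Proof.
move=> WB; split => [t t0 a x y|t t0|x|s t x s0 t0|x e e0].
- by rewrite /rescale (bsg_linear WB)//; lmod.
- have [C WC] := bsg_bounded WB t0; exists (cmod (cexp l t) * C) => x.
  by rewrite is_normZ// -mulrA ler_wpM2l ?cmod_ge0.
- by rewrite /rescale cexp0 scale1r (bsg0 WB).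
- rewrite /rescale (bsgD WB)// (linear_funZ (bsg_linear WB s0)) scalerA.
  by rewrite cexpD.
- have q1 : 0 < 1 + q x by rewrite ltr_wpDr ?pnorm_ge0.
  have e20 : 0 < e / 2 / (1 + q x) by rewrite !divr_gt0.
  have [d1 d10 ld] := cexp_cont l e20; have [d2 d20 ld1] := cexp_cont l ltr01.
  have [d3 d30 xd] := bsg_cont WB x (divr_gt0 e0 (ltr0n _ 4)).
  exists (Num.min d1 (Num.min d2 d3)); first by rewrite !lt_min d10 d20.
  move=> t /andP[t0]; rewrite !le_min => /and3P[td1 td2 td3].
  have := ld t; have := ld1 t; have := xd t; rewrite t0 td1 td2 td3.
  move=> /(_ isT) h1 /(_ isT) h2 /(_ isT); rewrite ler_pdivlMr// => h3.
  have -> : rescale l W t x - x = (cexp l t - 1) *: (W t x - x) +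
      ((W t x - x) + (cexp l t - 1) *: x) by rewrite /rescale; lmod.
  apply: le_trans (is_normD qN _ _) _.
  have := is_normD qN (W t x - x) ((cexp l t - 1) *: x); rewrite !(is_normZ qN).
  have := pnorm_ge0 qN (W t x - x); have := pnorm_ge0 qN x.
  have := cmod_ge0 (cexp l t - 1); nra.
Qed.

(** Product rule: the generator of exp(- l t) W(t) is that of W minus l. *)
Lemma rescale_right_derivative l W x y : right_derivative q W x y ->
  right_derivative q (rescale l W) x (y - l *: x).
Proof.
move=> xy e e0.
have q1 : 0 < 1 + q x by rewrite ltr_wpDr ?pnorm_ge0.
have q2 : 0 < 1 + q y by rewrite ltr_wpDr ?pnorm_ge0.
have [d1 d10 ld] := cexp_right_derivative l (divr_gt0 (divr_gt0 e0 (ltr0n _ 4)) q1).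
have [d2 d20 ld2] := cexp_cont l (divr_gt0 (divr_gt0 e0 (ltr0n _ 4)) q2).
have [d3 d30 xd] := xy _ (divr_gt0 e0 (ltr0n _ 4)).
have [d4 d40 ld4] := cexp_cont l ltr01.
exists (Num.min (Num.min d1 d4) (Num.min d2 d3)); first by rewrite !lt_min d10 d40 d20.
move=> h /andP[h0]; rewrite !le_min => /andP[/andP[h1 h4] /andP[h2 h3]].
have := ld h; have := ld2 h; have := xd h; have := ld4 h; rewrite h0 (ltW h0) h1 h2 h3 h4.
move=> /(_ isT) k4 /(_ isT) k3 /(_ isT); rewrite ler_pdivlMr// => k2 /(_ isT) k1.
have {}k1 : cmod (cexp l h - 1 + h%:C * l) * (1 + q x) <= e / 4 * h.
  by rewrite -ler_pdivlMr//; have -> : e / 4 * h / (1 + q x) = e / 4 / (1 + q x) * h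
    by field; rewrite gt_eqF.
have -> : rescale l W h x - x - h%:C *: (y - l *: x) =
   (W h x - x - h%:C *: y) + ((cexp l h - 1) *: (W h x - x - h%:C *: y) +
   ((cexp l h - 1 + h%:C * l) *: x + h%:C *: ((cexp l h - 1) *: y))).
  by rewrite /rescale; lmod.
set z := W h x - x - h%:C *: y in k3 *.
have t1 := is_normD qN z ((cexp l h - 1) *: z +
   ((cexp l h - 1 + h%:C * l) *: x + h%:C *: ((cexp l h - 1) *: y))).
have t2 := is_normD qN ((cexp l h - 1) *: z)
  ((cexp l h - 1 + h%:C * l) *: x + h%:C *: ((cexp l h - 1) *: y)).
have t3 := is_normD qN ((cexp l h - 1 + h%:C * l) *: x) (h%:C *: ((cexp l h - 1) *: y)).
have t4 : q ((cexp l h - 1) *: z) <= e / 4 * h.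
  by rewrite is_normZ//; have := pnorm_ge0 qN z; have := cmod_ge0 (cexp l h - 1); nra.
have t5 : q ((cexp l h - 1 + h%:C * l) *: x) <= e / 4 * h.
  rewrite is_normZ//; have := cmod_ge0 (cexp l h - 1 + h%:C * l); nra.
have t6 : q (h%:C *: ((cexp l h - 1) *: y)) <= e / 4 * h.
  rewrite pnormR ?(ltW h0)// is_normZ// mulrC ler_wpM2r ?(ltW h0)//.
  have := cmod_ge0 (cexp l h - 1); nra.
lra.
Qed.

Lemma rescaleK l W : rescale (- l) (rescale l W) = W.
Proof.
apply/funext => t; apply/funext => x; rewrite /rescale scalerA.
rewrite (_ : _ * _ = 1) ?scale1r// /cexp.
set a := complex.Re l; set b := complex.Im l.
have -> : complex.Re (- l) = - a by rewrite /a; case: (l).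
have -> : complex.Im (- l) = - b by rewrite /b; case: (l).
rewrite !mulNr opprK cosN sinN rmorphN /=.
set E := expR (a * t); have -> : expR (- (a * t)) = E^-1 by rewrite expRN.
set c := (cos _)%:C; set s := (sin _)%:C.
have -> : E%:C * (c - 'i%C * - s) * ((E^-1)%:C * (c - 'i%C * s)) =
  (E%:C * (E^-1)%:C) * (c ^+ 2 - 'i%C ^+ 2 * s ^+ 2) by ring.
rewrite -rmorphM /= divff ?gt_eqF ?expR_gt0// mul1r sqr_i mulN1r opprK.
by rewrite -!rmorphXn -rmorphD /= cos2Dsin2.
Qed.

Lemma right_derivative_rescale l W x y :
  right_derivative q (rescale l W) x y -> right_derivative q W x (y + l *: x).
Proof.
by move=> /(rescale_right_derivative (- l)); rewrite rescaleK scaleNr opprK.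
Qed.

(** In the norm p the semigroup satisfies the hypotheses of [csg_resolvent0]
    and [csg_injective0], and p is equivalent to q, so domains and generators
    are the same for both norms. *)
Definition stable_renorming W (p : V -> R) : Prop :=
  [/\ is_norm p, pnorm_complete p, contraction_semigroup p W,
      forall x, p (W 1 x) <= 2^-1 * p x &
      exists2 M, 1 <= M & forall x, q x <= p x <= M * q x].

(** With growth |W(t)| <= M exp(w t), taking Re l >= w + 2 M makes the
    rescaled semigroup decay like exp(- 2 M t), and M exp(- 2 M) <= 1/2. The
    bound at time 1 passes to the orbit norm because W(1) commutes with W(t).
    *)
Lemma stable_rescaling W : pnorm_complete q -> bounded_semigroup q W ->
  exists w, forall l, w <= complex.Re l ->
  exists p, stable_renorming (rescale l W) p.
Proof.
move=> qC WB; have [M M1 [w w0 WM]] := bsg_growth qN qC WB.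
exists (w + 2 * M) => l wl; have lB := rescale_bsg l WB.
have lM t x : 0 <= t -> q (rescale l W t x) <= M * expR (- (2 * M) * t) * q x.
  move=> t0; rewrite is_normZ// cmod_cexp.
  apply: (@le_trans _ _ (expR (- (complex.Re l * t)) * (M * expR (w * t) * q x))).
    by rewrite ler_wpM2l ?expR_ge0// WM.
  have -> : expR (- (complex.Re l * t)) * (M * expR (w * t) * q x) =
     M * (expR (- (complex.Re l * t)) * expR (w * t)) * q x by ring.
  rewrite -expRD ler_wpM2r ?pnorm_ge0// ler_wpM2l ?ler_expR//; last nra.
  by lra.
have lM' t x : 0 <= t -> q (rescale l W t x) <= M * q x.
  move=> t0; apply: le_trans (lM t x t0) _; rewrite ler_wpM2r ?pnorm_ge0//.
  rewrite ler_piMr//; first lra.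
  by rewrite -[leRHS]expR0 ler_expR mulNr oppr_le0 mulr_ge0//; lra.
exists (orbit_norm (q := q) (W := rescale l W)); split.
- exact (orbit_norm_is_norm qN lB lM').
- apply: (pnorm_complete_equiv qN qC (M := M)).
    exact (le_orbit_norm lB lM').
  exact (orbit_norm_le_mul lM').
- exact (orbit_norm_contraction qN lB lM').
- move=> x; apply: orbit_norm_le => t t0.
  rewrite -(bsgD lB)// addrC (bsgD lB)//.
  apply: le_trans (lM 1 _ ler01) _; rewrite mulr1.
  apply: ler_pM; rewrite ?pnorm_ge0 ?mulr_ge0 ?expR_ge0//; first lra.
    rewrite expRN ler_pdivrMr ?expR_gt0//; have := expR_ge1Dx (2 * M); lra.
  exact (orbit_norm_ub lM' x t0).
- exists M => // x; rewrite (le_orbit_norm lB lM')/=.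
  exact (orbit_norm_le_mul lM' x).
Qed.

Lemma right_derivative_renorm p W M : (forall x, q x <= p x <= M * q x) -> 1 <= M ->
  forall x y, right_derivative p W x y <-> right_derivative q W x y.
Proof.
move=> qp M1 x y; have M0 : 0 < M by lra.
split=> xy e e0.
  have [d d0 xd] := xy e e0; exists d => // h /xd; apply: le_trans.
  by have /andP[] := qp (W h x - x - h%:C *: y).
have [d d0 xd] := xy _ (divr_gt0 e0 M0); exists d => // h /xd {}xd.
have /andP[_ /le_trans] := qp (W h x - x - h%:C *: y); apply.
rewrite mulrC -ler_pdivlMr//; apply: le_trans xd _.
by have -> : e / M * h = e * h / M by field; rewrite gt_eqF.
Qed.

(** The resolvent at l of the generator of W is minus the inverse of the
    generator of the rescaled semigroup. *)
Lemma semigroup_resolvent W : pnorm_complete q -> bounded_semigroup q W ->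
  exists w, forall l, w <= complex.Re l ->
    (forall x, right_derivative q W x (l *: x) -> x = 0) /\
    exists C, forall y, exists2 x,
      right_derivative q W x (l *: x - y) & q x <= C * q y.
Proof.
move=> qC WB; have [w wP] := stable_rescaling qC WB; exists w => l /wP.
move=> [p [pN pC lC l1 [M M1 qp]]]; have iff := right_derivative_renorm (rescale l W) qp M1.
split=> [x|].
  move=> /(rescale_right_derivative l); rewrite subrr => /iff.
  exact: (csg_injective0 pN lC l1).
exists (2 * M) => y; have [x xy xle] := csg_resolvent0 pN pC lC l1 y.
exists x; first by move: xy => /iff /right_derivative_rescale; rewrite addrC.
have /andP[h1 _] := qp x; have /andP[_ h2] := qp y; lra.
Qed.

End Rescaling.

(** * The implicit Euler scheme *)

Section EulerScheme.
Context {R : realType} {V : lmodType R[i]} {p : V -> R} (pN : is_norm p).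
Context (pC : pnorm_complete p).
Context {W : R -> V -> V} (WC : contraction_semigroup p W).

Lemma right_derivative_linear a x y x' y' : right_derivative p W x y ->
  right_derivative p W x' y' ->
  right_derivative p W (a *: x + x') (a *: y + y').
Proof.
move=> xy xy' e e0; have a1 : 0 < 1 + cmod a by rewrite ltr_wpDr ?cmod_ge0.
have e20 : 0 < e / 2 by lra.
have [d1 d10 h1] := xy _ (divr_gt0 e20 a1); have [d2 d20 h2] := xy' _ e20.
exists (Num.min d1 d2); first by rewrite lt_min d10.
move=> h /andP[h0]; rewrite le_min => /andP[hd1 hd2].
have := h1 h; have := h2 h; rewrite h0 hd1 hd2 => /(_ isT) k2 /(_ isT) k1.
have -> : W h (a *: x + x') - (a *: x + x') - h%:C *: (a *: y + y') =
    a *: (W h x - x - h%:C *: y) + (W h x' - x' - h%:C *: y').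
  by rewrite (csg_linear WC (ltW h0)); lmod.
apply: le_trans (is_normD pN _ _) _; rewrite is_normZ//.
have := pnorm_ge0 pN (W h x - x - h%:C *: y); have := cmod_ge0 a.
have {k1} : p (W h x - x - h%:C *: y) * (1 + cmod a) <= e / 2 * h.
  rewrite -ler_pdivlMr//; apply: le_trans k1 _.
  by have -> : e / 2 * h / (1 + cmod a) = e / 2 / (1 + cmod a) * h
    by field; rewrite gt_eqF.
by nra.
Qed.

Lemma right_derivative_csg t x y : 0 <= t -> right_derivative p W x y ->
  right_derivative p W (W t x) (W t y).
Proof.
move=> t0 xy e /xy[d d0 xd]; exists d => // h hd; apply: le_trans (xd h hd).
move: hd => /andP[/ltW h0 _].
rewrite (csg_comm WC)// -(linear_funZ (csg_linear WC t0)).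
by rewrite -!(linear_funB (csg_linear WC t0)); exact: csg_le WC _ _ t0.
Qed.

(** For a small step d the vector x - h y is (1 + h / d) x - (h / d) W(d) x up
    to an error of order h, and W(d) does not increase the norm. *)
Lemma dissipative h x y : 0 <= h -> right_derivative p W x y ->
  p x <= p (x - h%:C *: y).
Proof.
move=> h0 xy; apply: (le_small h0) => e e0 _.
have [d d0 /(_ d)] := xy e e0; rewrite d0 lexx => /(_ isT).
set z := _ - _ *: y => ze; have dge0 := ltW d0.
have : p ((1 + h / d)%:C *: x) <= p (x - h%:C *: y) + h / d * p x + h * e.
  have -> : (1 + h / d)%:C *: x =
      (x - h%:C *: y) + ((h / d)%:C *: W d x - (h / d)%:C *: z).
    have hd : h%:C = (h / d)%:C * d%:C :> R[i].
      by rewrite -rmorphM /= divfK ?gt_eqF.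
    by rewrite hd rmorphD /= /z; lmod.
  apply: le_trans (is_normD pN _ _) _; rewrite -addrA lerD2l.
  apply: le_trans (pnormB pN _ _) _.
  have hd0 : 0 <= h / d by rewrite divr_ge0.
  rewrite !(pnormR pN)//; have -> : h * e = h / d * (e * d).
    by field; rewrite gt_eqF.
  by apply: lerD; apply: ler_wpM2l => //; exact (csg_le WC x dge0).
rewrite (pnormR pN); last by rewrite addr_ge0// divr_ge0.
by rewrite mulrDl mul1r; lra.
Qed.

(** Means of orbits over short intervals lie in the domain of the generator
    and approximate the vector. *)
Lemma mean_dense x e : 0 < e ->
  exists z w, right_derivative p W z w /\ p (z - x) <= e.
Proof.
move=> e0; have [d d0 xd] := csg_cont WC x e0.
exists (mean (p := p) (W := W) d x); eexists; split.
  exact (mean_right_derivative pN pC WC x d0).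
by apply: (mean_near pN pC WC (ltW d0)) => r rd; exact: xd.
Qed.

Context {J : R -> V -> V} (JW : forall h z, 0 < h ->
  right_derivative p W (J h z) (h^-1%:C *: (J h z - z))).

(** [J h] plays the role of (1 - h B)^-1 with B the generator of W.
    Uniqueness, which follows from dissipativity, yields all its algebraic
    properties. *)
Lemma implicit_step_unique h x z : 0 < h ->
  right_derivative p W x (h^-1%:C *: (x - z)) -> x = J h z.
Proof.
move=> h0 xz; apply/eqP; rewrite -subr_eq0; apply/eqP/(is_norm_eq0 pN).
apply/eqP; rewrite eq_le pnorm_ge0// andbT.
have := right_derivative_linear (-1) (JW z h0) xz.
move=> /(dissipative (ltW h0)); rewrite scaleN1r [- _ + x]addrC => /le_trans; apply.
have hh : h%:C * h^-1%:C = 1 :> R[i] by rewrite -rmorphM /= divff ?gt_eqF.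
rewrite (_ : _ - _ = (1 - h%:C * h^-1%:C) *: (x - J h z)); last by lmod.
by rewrite hh subrr scale0r (pnorm0 pN).
Qed.

Lemma implicit_step_le h z : 0 < h -> p (J h z) <= p z.
Proof.
move=> h0; have := dissipative (ltW h0) (JW z h0).
rewrite scalerA -rmorphM /= divff ?gt_eqF// scale1r.
by have -> : J h z - (J h z - z) = z by lmod.
Qed.

Lemma implicit_step_linear h : 0 < h -> linear (J h).
Proof.
move=> h0 a x y; apply/esym/implicit_step_unique => //.
have := right_derivative_linear a (JW x h0) (JW y h0).
by congr right_derivative; lmod.
Qed.

Lemma implicit_step_csg h t z : 0 < h -> 0 <= t -> J h (W t z) = W t (J h z).
Proof.
move=> h0 t0; apply/esym/implicit_step_unique => //.
have := right_derivative_csg t0 (JW z h0).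
by rewrite (linear_funZ (csg_linear WC t0)) (linear_funB (csg_linear WC t0)).
Qed.

(** J h x - x = h J h (B x), in view of J h (x - h B x) = x. *)
Lemma implicit_step_smooth h x y : 0 < h -> right_derivative p W x y ->
  J h x - x = h%:C *: J h y.
Proof.
move=> h0 xy; have Jl := implicit_step_linear h0.
have e : x = J h (x - h%:C *: y).
  apply: implicit_step_unique => //.
  rewrite (_ : x - _ = h%:C *: y) ?scalerA; last by lmod.
  by rewrite -rmorphM /= mulVf ?gt_eqF// scale1r.
rewrite {2}e (linear_funB Jl) (linear_funZ Jl); lmod.
Qed.

(** Immediate from [implicit_step_smooth] on the domain of the generator, and
    the domain is dense while the J h are contractions. *)
Lemma implicit_step_cvg x e : 0 < e -> exists2 d, 0 < d &
  forall h, 0 < h <= d -> p (J h x - x) <= e.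
Proof.
move=> e0; have e30 : 0 < e / 3 by lra.
have [z [w [zw zx]]] := mean_dense x e30.
have w1 : 0 < 1 + p w by rewrite ltr_wpDr ?pnorm_ge0.
exists (e / 3 / (1 + p w)); first by rewrite divr_gt0.
move=> h /andP[h0]; rewrite ler_pdivlMr// => hw.
have -> : J h x - x = (J h z - z) - (J h (z - x) - (z - x)).
  by rewrite (linear_funB (implicit_step_linear h0)); lmod.
rewrite (implicit_step_smooth h0 zw); apply: le_trans (pnormB pN _ _) _.
rewrite pnormR ?(ltW h0)//.
have := pnormB pN (J h (z - x)) (z - x).
have := implicit_step_le (z - x) h0; have := implicit_step_le w h0.
have := pnorm_ge0 pN (J h w); nra.
Qed.

(** Both W(h) x and J h x are x + h B x up to o(h). *)
Lemma implicit_step_consistent x y e : right_derivative p W x y -> 0 < e ->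
  exists2 d, 0 < d & forall h, 0 < h <= d -> p (W h x - J h x) <= e * h.
Proof.
move=> xy e0; have e20 : 0 < e / 2 by lra.
have [d1 d10 k1] := xy _ e20; have [d2 d20 k2] := implicit_step_cvg y e20.
exists (Num.min d1 d2); first by rewrite lt_min d10.
move=> h /andP[h0]; rewrite le_min => /andP[h1 h2].
have := k1 h; have := k2 h; rewrite h0 h1 h2 => /(_ isT) l2 /(_ isT) l1.
have -> : W h x - J h x = (W h x - x - h%:C *: y) - h%:C *: (J h y - y).
  rewrite scalerBr -(implicit_step_smooth h0 xy); lmod.
apply: le_trans (pnormB pN _ _) _; rewrite pnormR ?(ltW h0)//; nra.
Qed.

(** W(h) and J h are commuting contractions, so replacing the n factors W(h)
    by J h one at a time costs at most |W(h) x - J h x| each. *)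
Lemma iter_implicit_step_dist n h x : 0 < h ->
  p (W (n%:R * h) x - iter n (J h) x) <= n%:R * p (W h x - J h x).
Proof.
move=> h0; have hge0 := ltW h0.
elim: n => [|n IH]; first by rewrite !mul0r (csg0 WC) subrr (pnorm0 pN).
have nh0 : 0 <= n%:R * h by rewrite mulr_ge0.
have -> : n.+1%:R * h = h + n%:R * h by rewrite -natr1; ring.
rewrite (csgD WC)//=.
have -> : W h (W (n%:R * h) x) - J h (iter n (J h) x) =
    W (n%:R * h) (W h x - J h x) + J h (W (n%:R * h) x - iter n (J h) x).
  rewrite (linear_funB (csg_linear WC nh0)) (linear_funB (implicit_step_linear h0)).
  by rewrite implicit_step_csg// (csg_comm WC _ hge0 nh0); lmod.
apply: le_trans (is_normD pN _ _) _.
have := implicit_step_le (W (n%:R * h) x - iter n (J h) x) h0.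
have := csg_le WC (W h x - J h x) nh0.
by rewrite -natr1; lra.
Qed.

(** On the domain of the generator, W(t) x is the limit of the n-th iterates
    of J (t / n) at x, by consistency and stability. For general z the vectors
    J d z lie in Y and in the domain, and tend to z. *)
Lemma csg_invariant (Y : set V) :
  (forall x, (forall e, 0 < e -> exists2 y, Y y & p (x - y) <= e) -> Y x) ->
  (forall h z, 0 < h -> Y z -> Y (J h z)) ->
  forall t z, 0 <= t -> Y z -> Y (W t z).
Proof.
move=> Ycl YJ.
have smooth t x y : 0 < t -> right_derivative p W x y -> Y x -> Y (W t x).
  move=> t0 xy Yx; apply: Ycl => e e0.
  have [d d0 xd] := implicit_step_consistent xy (divr_gt0 e0 t0).
  have [N /(_ _ (leqnn _)) Nd] := invr_small (ltW t0) d0.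
  have h0 : 0 < t / N.+1%:R by rewrite divr_gt0.
  exists (iter N.+1 (J (t / N.+1%:R)) x).
    by elim: {1}N.+1 => //= n IH; exact: YJ.
  have /le_trans := iter_implicit_step_dist N.+1 x h0.
  rewrite [N.+1%:R * (t / _)]mulrC divfK ?pnatr_eq0//; apply.
  have /xd : 0 < t / N.+1%:R <= d by rewrite h0.
  rewrite mulrA divfK ?gt_eqF//.
  by rewrite ler_pdivlMr ?ltr0Sn// mulrC.
move=> t z t0 Yz; apply: Ycl => e e0.
have [d d0 zd] := implicit_step_cvg z e0.
have dd : 0 < d <= d by rewrite d0 lexx.
exists (W t (J d z)).
  move: t0; rewrite le_eqVlt => /predU1P[<-|t0]; first by rewrite (csg0 WC); exact: YJ.
  exact: smooth t0 (JW z d0) (YJ _ _ d0 Yz).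
rewrite -(linear_funB (csg_linear WC t0)); apply: le_trans (csg_le WC _ t0) _.
by rewrite (pnormC pN); exact: zd.
Qed.

End EulerScheme.

(** * Invariance along a half line of resolvents *)

(** Connectedness of [0, +oo), by considering the supremum of the initial
    segments on which P holds. *)
Lemma locally_constant_on_half_line {R : realType} (P : R -> Prop) : P 0 ->
  (forall s, 0 <= s -> exists2 r, 0 < r &
     forall u, 0 <= u -> `|u - s| <= r -> P s <-> P u) ->
  forall s, 0 <= s -> P s.
Proof.
move=> P0 loc s1 s10; apply: contrapT => nP.
pose S := [set s | 0 <= s /\ forall u, 0 <= u <= s -> P u].
have S0 : S 0.
  by split=> // u; rewrite -eq_le => /eqP <-.
have Sub : ubound S s1.
  move=> s [s0 sP]; rewrite leNgt; apply/negP => s1s; apply: nP; apply: sP.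
  by rewrite s10 ltW.
have supS : has_sup S by split; [exists 0 | exists s1].
have m0 : 0 <= sup S by exact: (sup_upper_bound supS).
have [r r0 rP] := loc _ m0.
have [s [s0 sP] ms] := sup_adherent r0 supS.
have sm : s <= sup S by exact: (sup_upper_bound supS).
have Pm : P (sup S).
  by apply/(rP s) => //; [rewrite distrC ger0_norm; lra | apply: sP; rewrite s0 lexx].
have : S (sup S + r).
  split; first by rewrite addr_ge0// ltW.
  move=> u /andP[u0 ur]; have [us|su] := lerP u s; first by apply: sP; rewrite u0.
  by apply/(rP u) => //; rewrite ler_norml; apply/andP; split; lra.
by move=> /(sup_upper_bound supS); lra.
Qed.

Section ResolventInvariance.
Context {R : realType} {V U : lmodType R[i]} {q : V -> R} {qU : U -> R}.
Context (qN : is_norm q) (qUN : is_norm qU).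
Context {pr : V -> U} (prl : linear pr) (prq : forall x, qU (pr x) <= q x).
Context {G : R -> V -> V}.
Context (Gb : forall s, 0 <= s -> exists C, forall x, q (G s x) <= C * q x).
Context (Gres : forall s s' y, 0 <= s -> 0 <= s' ->
  G s' y = G s y + (s - s')%:C *: G s' (G s y)).

Let Inv s := forall y, pr y = 0 -> pr (G s y) = 0.

(** Here G s is the resolvent at l + s and the subspace is the kernel of pr.
    For y in it, the resolvent identity gives pr (G s' y) = (s - s') pr (G s'
    (G s y)) with G s y again in the subspace and |s - s'| |G s| <= 1/2; so a
    bound for pr o G s' on the subspace can be halved indefinitely. *)
Lemma resolvent_invariant_step s s' K : 0 <= s -> 0 <= s' -> 0 <= K ->
  (forall x, q (G s x) <= K * q x) -> `|s - s'| * K <= 2^-1 -> Inv s -> Inv s'.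
Proof.
move=> s0 s'0 K0 GK sK Is y y0; apply: (pnorm_small0 qUN) => e e0.
have [C' GC'] := Gb s'0; pose C := `|C'|.
have GC x : q (G s' x) <= C * q x.
  by rewrite (le_trans (GC' x))// ler_wpM2r ?pnorm_ge0// ler_norm.
have bnd n : forall z, pr z = 0 -> qU (pr (G s' z)) <= C * q z * 2^-1 ^+ n.
  elim: n => [|n IH] z z0; first by rewrite expr0 mulr1 (le_trans (prq _)).
  rewrite (Gres z s0 s'0) (linear_funD prl) (linear_funZ prl) (Is z z0) add0r.
  rewrite is_normZ// cmodR; have := IH _ (Is z z0).
  have := pnorm_ge0 qN z; have := pnorm_ge0 qUN (pr (G s' (G s z))).
  set D := `|s - s'| in sK *; have D0 : 0 <= D by exact: normr_ge0.
  have h0 := half_pow_gt0 (R := R) n; rewrite exprS; set hn := 2^-1 ^+ n in h0 *.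
  move=> qu0 qz0 le1.
  have C0 : 0 <= C by exact: normr_ge0.
  apply: le_trans (ler_wpM2l D0 le1) _.
  have -> : D * (C * q (G s z) * hn) = (D * q (G s z)) * (C * hn) by ring.
  have -> : C * q z * (2^-1 * hn) = (2^-1 * q z) * (C * hn) by ring.
  apply: ler_wpM2r; first by rewrite mulr_ge0// ltW.
  apply: le_trans (ler_wpM2l D0 (GK z)) _; rewrite mulrA.
  by apply: ler_wpM2r.
have Cq0 : 0 <= C * q y by rewrite mulr_ge0 ?pnorm_ge0// normr_ge0.
have [n /(_ _ (leqnn _))] := half_pow_small Cq0 e0.
by apply: le_trans; exact: bnd.
Qed.

(** Needed to make [resolvent_invariant_step] symmetric in s and u: the size
    of the admissible steps around u is controlled by the bound at s. *)
Lemma resolvent_bound_near s u C : 0 <= s -> 0 <= u -> 0 <= C ->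
  (forall x, q (G s x) <= C * q x) -> `|u - s| * C <= 2^-1 ->
  forall x, q (G u x) <= 2 * C * q x.
Proof.
move=> s0 u0 C0 GC usC x.
have e : G s x - (u - s)%:C *: G s (G u x) = G u x.
  by rewrite (Gres x u0 s0); lmod.
have := pnormB qN (G s x) ((u - s)%:C *: G s (G u x)); rewrite e is_normZ// cmodR.
have := GC x; have := GC (G u x); have := pnorm_ge0 qN (G u x).
have := normr_ge0 (u - s); have := pnorm_ge0 qN (G s (G u x)).
set D := `|_| in usC *; move=> a0 D0 g0 h1 h2 h3.
have : D * q (G s (G u x)) <= 2^-1 * q (G u x).
  by apply: le_trans (ler_wpM2l D0 h1) _; rewrite mulrA ler_wpM2r.
by lra.
Qed.

Lemma resolvent_invariant s : 0 <= s -> Inv 0 -> Inv s.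
Proof.
move=> + I0; apply: (locally_constant_on_half_line (P := Inv)) => // {}s s0.
have [C' GC'] := Gb s0; pose C := `|C'| + 1; have C0 : 0 < C by rewrite ltr_wpDl.
have Cge0 := ltW C0.
have GC x : q (G s x) <= C * q x.
  rewrite (le_trans (GC' x))// ler_wpM2r ?pnorm_ge0//.
  by rewrite (le_trans (ler_norm _))// lerDl.
exists (4^-1 / C); first by rewrite divr_gt0// invr_gt0.
move=> u u0; rewrite ler_pdivlMr// => usC.
have G2 := resolvent_bound_near s0 u0 Cge0 GC ltac:(lra).
split.
  by apply: resolvent_invariant_step Cge0 GC _ => //; rewrite distrC; lra.
apply: resolvent_invariant_step G2 _ => //; last by lra.
by rewrite mulr_ge0.
Qed.

End ResolventInvariance.

(** * Normed modules, generators and resolvent sets *)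

(** The norm as an element of R instead of R[i]. *)
Definition rnorm {R : realType} {V : normedModType R[i]} (x : V) : R :=
  complex.Re `|x|.

Lemma pos_complexP {R : realType} (e : R[i]) : 0 < e ->
  exists2 r : R, e = r%:C & 0 < r.
Proof.
rewrite ltcE /= => /andP[/eqP Ime Ree]; exists (complex.Re e) => //.
by case: e Ime {Ree} => a b /= ->.
Qed.

Section RealValuedNorm.
Context {R : realType} {V : normedModType R[i]}.
Implicit Types x y : V.

Lemma rnormE x : `|x| = (rnorm x)%:C.
Proof. by rewrite /rnorm RRe_real// normr_real. Qed.

Lemma rnorm_le x (r : R) : (rnorm x <= r) = (`|x| <= r%:C).
Proof. by rewrite rnormE lecR. Qed.

Lemma rnorm_is_norm : is_norm (rnorm : V -> R).
Proof.
split=> [x y|a x|x x0].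
- by rewrite rnorm_le rmorphD /= -!rnormE ler_normD.
- by apply: complexI; rewrite -rnormE normrZ cmodE rnormE rmorphM.
- by apply/eqP; rewrite -normr_eq0 rnormE x0.
Qed.

Lemma rnorm_cvgP {T : Type} {F : set_system T} {FF : Filter F} (f : T -> V) y :
  f x @[x --> F] --> y <->
  (forall e : R, 0 < e -> \forall x \near F, rnorm (f x - y) <= e).
Proof.
split=> [/cvgrPdist_le fy e e0|fy].
  have e0' : 0 < e%:C :> R[i] by rewrite ltcR.
  by apply: filterS (fy _ e0') => x; rewrite rnorm_le distrC.
apply/cvgrPdist_le => _ /pos_complexP[e -> e0].
by apply: filterS (fy _ e0) => x; rewrite rnorm_le distrC.
Qed.

Lemma rnorm_right_cvgP (f : R -> V) y :
  f h @[h --> 0^'+] --> y <-> (forall e : R, 0 < e -> exists2 d : R, 0 < d &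
    forall h, 0 < h <= d -> rnorm (f h - y) <= e).
Proof.
split=> [/rnorm_cvgP fy e e0|fy].
  have [d /= d0 fd] := fy e e0; exists (d / 2); first by rewrite divr_gt0.
  move=> h /andP[h0 hd]; apply: fd => //=.
  by rewrite sub0r normrN gtr0_norm//; lra.
apply/rnorm_cvgP => e e0; have [d d0 fd] := fy e e0; exists d => //= h /=.
rewrite sub0r normrN => hd h0; apply: fd; rewrite h0 /=.
by move: hd; rewrite gtr0_norm// => /ltW.
Qed.

(** Relates the explicit form of differentiability to the limit of difference
    quotients that defines a generator. *)
Lemma right_derivative_cvgP (T : R -> V -> V) x y :
  right_derivative rnorm T x y <->
  (h^-1)%:C *: (T h x - x) @[h --> 0^'+] --> y.
Proof.
have key h e : 0 < h -> (rnorm ((h^-1)%:C *: (T h x - x) - y) <= e) =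
    (rnorm (T h x - x - h%:C *: y) <= e * h).
  move=> h0; rewrite mulrC -(ler_pM2l h0) -(pnormR rnorm_is_norm _ (ltW h0)).
  congr (rnorm _ <= _); rewrite scalerBr scalerA -rmorphM /= divff ?gt_eqF//.
  by rewrite scale1r.
split=> [xy|/rnorm_right_cvgP xy e /xy[d d0 xd]].
  apply/rnorm_right_cvgP => e /xy[d d0 xd]; exists d => // h hd.
  by rewrite key; [exact: xd | case/andP: hd].
by exists d => // h hd; rewrite -key; [exact: xd | case/andP: hd].
Qed.

End RealValuedNorm.

Lemma bounded_operatorP {R : realType} {V W : normedModType R[i]} (f : V -> W) :
  bounded_operator f <->
  linear f /\ exists C, forall x, rnorm (f x) <= C * rnorm x.
Proof.
split=> -[fl fb]; split=> //.
  pose F : {linear V -> W} := HB.pack f (GRing.isLinear.Build _ _ _ _ f fl).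
  have /pinfty_ex_gt0[_ /pos_complexP[C -> C0] FC] := (linear_boundedP F).1 fb.
  by exists C => x; rewrite rnorm_le rmorphM /= -rnormE; exact: FC.
apply/ex_bound; have [C fC] := fb; exists `|C|%:C.
apply/nbhs_normP; exists 1 => //= x /=; rewrite sub0r normrN rnormE.
rewrite -[1]/(1%:C) ltcR => x1.
rewrite -rnorm_le (le_trans (fC x))//; have := ler_norm C; have := normr_ge0 C.
by have := pnorm_ge0 (rnorm_is_norm (V := V)) x; nra.
Qed.

Lemma C0_semigroup_bounded {R : realType} {V : normedModType R[i]}
    (T : R -> V -> V) : C0_semigroup T -> bounded_semigroup rnorm T.
Proof.
move=> [Tb T0 TD Tc]; split=> [t t0|t t0|x|s t x s0 t0|x e e0].
- by have /bounded_operatorP[] := Tb t t0.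
- by have /bounded_operatorP[] := Tb t t0.
- by rewrite T0.
- by rewrite TD.
have /subspace_continuousP/(_ 0) := Tc x.
move=> /(_ _)/rnorm_cvgP/(_ e e0); rewrite /= in_itv /= lexx => /(_ isT)[d /= d0 xd].
have {}xd t : `|0 - t| < d -> t \in `[0, +oo[ -> rnorm (T t x - T 0 x) <= e.
  exact: xd.
exists (d / 2); first by rewrite divr_gt0.
rewrite T0 in xd; move=> t /andP[t0 td]; apply: xd.
  by rewrite sub0r normrN ger0_norm//; lra.
by rewrite in_itv /= t0.
Qed.

Lemma rnorm_complete {R : realType} (E : completeNormedModType R[i]) :
  pnorm_complete (rnorm : E -> R).
Proof.
move=> u uC.
have : cauchy (u @ \oo).
  apply: cauchy_exP => _ /pos_complexP[e -> e0].
  have e20 : 0 < e / 2 by lra.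
  have [N Ne] := uC _ e20; exists (u N); exists N => //= n /= Nn.
  rewrite -ball_normE /= distrC rnormE ltcR.
  by have := Ne (n - N)%N; rewrite subnKC//; lra.
move=> /cauchy_cvgP /cvg_ex[l ul]; exists l => e e0.
have /rnorm_cvgP /(_ e e0) [N _ Ne] := ul.
by exists N => n Nn; exact: Ne.
Qed.

Section ProductNorm.
Context {R : realType} {E F : normedModType R[i]}.
Implicit Types z : (E * F)%type.

Lemma rnorm_pair z : rnorm z = Num.max (rnorm z.1) (rnorm z.2).
Proof.
apply: complexI; rewrite -rnormE prod_normE !rnormE.
by have [h|h] := lerP (rnorm z.1) (rnorm z.2); [rewrite max_r ?lecR|rewrite max_l ?lecR// ltW].
Qed.

Lemma rnorm_fst z : rnorm z.1 <= rnorm z.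
Proof. by rewrite rnorm_pair le_max lexx. Qed.

Lemma rnorm_snd z : rnorm z.2 <= rnorm z.
Proof. by rewrite rnorm_pair le_max lexx orbT. Qed.

Lemma rnorm_inl (x : E) : rnorm ((x, 0) : (E * F)%type) = rnorm x.
Proof.
rewrite rnorm_pair /= (pnorm0 rnorm_is_norm) max_l//; exact: pnorm_ge0 rnorm_is_norm _.
Qed.

Lemma rnorm_inr (y : F) : rnorm ((0, y) : (E * F)%type) = rnorm y.
Proof.
rewrite rnorm_pair /= (pnorm0 rnorm_is_norm) max_r//; exact: pnorm_ge0 rnorm_is_norm _.
Qed.

Lemma rnorm_complete_prod : pnorm_complete (rnorm : E -> R) ->
  pnorm_complete (rnorm : F -> R) -> pnorm_complete (rnorm : (E * F)%type -> R).
Proof.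
move=> Ec Fc u uC.
have [|x ux] := Ec (fun n => (u n).1).
  by move=> e /uC[N Ne]; exists N => m; exact: le_trans (rnorm_fst _) (Ne m).
have [|y uy] := Fc (fun n => (u n).2).
  by move=> e /uC[N Ne]; exists N => m; exact: le_trans (rnorm_snd _) (Ne m).
exists (x, y) => e e0; have [N1 h1] := ux e e0; have [N2 h2] := uy e e0.
exists (maxn N1 N2) => n; rewrite geq_max => /andP[/h1 k1 /h2 k2].
by rewrite rnorm_pair ge_max k1.
Qed.

End ProductNorm.

Section GeneratorResolvent.
Context {R : realType} {V : normedModType R[i]} (VC : pnorm_complete (rnorm : V -> R)).
Context {A : unbounded_operator V}.

(** A bounded right inverse that depends on choices is linear and two-sided as
    soon as l - A is injective. *)
Lemma resolvent_setP (l : R[i]) :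
  (forall x, op_dom A x -> A x = l *: x -> x = 0) ->
  (exists C, forall y, exists2 x,
     op_dom A x /\ A x = l *: x - y & rnorm x <= C * rnorm y) ->
  resolvent_set A l.
Proof.
move=> inj [C surj].
have [B BP] : {B : V -> V & forall y,
    (op_dom A (B y) /\ A (B y) = l *: B y - y) /\ rnorm (B y) <= C * rnorm y}.
  apply: (@choice _ _ (fun y x => (op_dom A x /\ A x = l *: x - y) /\
    rnorm x <= C * rnorm y)) => y.
  by have [x xy xle] := surj y; exists x.
have uniq x y : op_dom A x -> op_dom A y -> l *: x - A x = l *: y - A y -> x = y.
  move=> Dx Dy e; apply/eqP; rewrite -subr_eq0; apply/eqP/inj.
    by rewrite addrC -scaleN1r; exact: op_domP.
  rewrite addrC -scaleN1r op_linear// (_ : A x = l *: x - (l *: y - A y)).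
    by lmod.
  by rewrite -e; lmod.
have BE y : l *: B y - A (B y) = y.
  by have [[_ ->] _] := BP y; lmod.
exists B; split.
- apply/bounded_operatorP; split; last by exists C => y; have [] := BP y.
  move=> a x y; have [[Dxy _] _] := BP (a *: x + y).
  have [[Dx _] _] := BP x; have [[Dy _] _] := BP y.
  apply: uniq => //; first exact: op_domP.
  rewrite BE op_linear// -{1}(BE x) -{1}(BE y); lmod.
- by move=> y; split; [have [[]] := BP y | exact: BE].
- by move=> x Dx; have [[DB _] _] := BP (l *: x - A x); apply: uniq.
Qed.

Lemma generator_resolvent (T : R -> V -> V) :
  C0_semigroup T -> is_generator T A ->
  exists w, forall l : R[i], w <= complex.Re l -> resolvent_set A l.
Proof.
move=> /C0_semigroup_bounded TB gA.
have gE x y : op_dom A x /\ A x = y <-> right_derivative rnorm T x y.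
  by rewrite right_derivative_cvgP; exact: gA.
have [w wP] := semigroup_resolvent rnorm_is_norm VC TB.
exists w => l /wP[inj [C surj]]; apply: resolvent_setP.
  by move=> x Dx Ax; apply: inj; apply/gE.
by exists C => y; have [x /gE xy xle] := surj y; exists x.
Qed.

End GeneratorResolvent.

(** * Triangular semigroups and the corner operator *)

Section Corner.
Context {R : realType} {E F : normedModType R[i]}.
Context {AA : unbounded_operator (E * F)%type} {TT : R -> E * F -> E * F}.
Context (hTT : C0_semigroup TT) (hAA : is_generator TT AA).

Section Triangular.
Context {T : R -> E -> E} {U : R -> F -> E} {S : R -> F -> F}.
Context (tri : upper_triangular_form TT T U S).

Lemma triangular_inl t x : 0 <= t -> TT t (x, 0) = (T t x, 0).
Proof.
move=> t0; have [_ [Ul _] [Sl _] ->] := tri t0.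
by rewrite /block_operator /= (linear_fun0 Ul) (linear_fun0 Sl) !addr0.
Qed.

Lemma triangular_semigroup : C0_semigroup T.
Proof.
have [Tb T0 TD Tc] := hTT; split=> [t t0||s t s0 t0|x].
- by have [] := tri t0.
- apply/funext => x; have := triangular_inl x (lexx 0); rewrite T0 => -[].
  by [].
- apply/funext => x; have := triangular_inl x (addr_ge0 s0 t0).
  by rewrite TD//= triangular_inl// triangular_inl// => -[].
apply: (@subspace_eq_continuous _ _ _ (fun t => (TT t (x, 0)).1)).
  by move=> t; rewrite inE /= in_itv /= andbT => t0; rewrite triangular_inl.
apply/subspace_continuousP => t t0.
have /subspace_continuousP/(_ t t0) := Tc (x, 0).
move=> /rnorm_cvgP tc; apply/rnorm_cvgP => e /tc; apply: filterS => s.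
by apply: le_trans; exact: (rnorm_fst (TT s (x, 0) - TT t (x, 0))).
Qed.

Lemma triangular_quotient h x y : 0 < h -> 
  TT h (x, 0) - (x, 0) - h%:C *: ((y, 0) : (E * F)%type) =
  (T h x - x - h%:C *: y, 0).
Proof.
move=> /ltW h0; rewrite triangular_inl//; congr pair => /=.
by rewrite scaler0 !subr0.
Qed.

Lemma triangular_right_derivative x y :
  right_derivative rnorm TT (x, 0) (y, 0) <-> right_derivative rnorm T x y.
Proof.
by split=> xy e /xy[d d0 xd]; exists d => // h hd; have := xd h hd;
  case/andP: hd => h0 _; rewrite triangular_quotient// rnorm_inl.
Qed.

(** The difference quotients at (x, 0) have zero second component, hence so
    does their limit. *)
Lemma triangular_generator_snd x : op_dom AA (x, 0) -> (AA (x, 0)).2 = 0.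
Proof.
move=> Dx; apply: (pnorm_small0 rnorm_is_norm) => e e0.
have /right_derivative_cvgP/(_ e e0) [d d0 xd] :=
  (hAA (x, 0) (AA (x, 0))).1 (conj Dx erefl).
have dd : 0 < d <= d by rewrite d0 lexx.
have := le_trans (rnorm_snd _) (xd d dd); rewrite triangular_inl ?(ltW d0)//=.
rewrite subrr sub0r (pnormN rnorm_is_norm) (pnormR rnorm_is_norm) ?(ltW d0)//.
by rewrite mulrC ler_pM2r.
Qed.

Lemma triangular_generator : is_generator T (corner_operator AA).
Proof.
move=> x y; rewrite -right_derivative_cvgP -triangular_right_derivative.
rewrite right_derivative_cvgP -(hAA (x, 0) (y, 0)).
split=> -[Dx Ax]; split=> //.
  apply/eqP; rewrite [AA _]surjective_pairing xpair_eqE.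
  by rewrite triangular_generator_snd// eqxx andbT; apply/eqP.
by rewrite /= /corner_fun Ax.
Qed.

End Triangular.

Lemma block_decomposition :
  (forall t x, 0 <= t -> (TT t (x, 0)).2 = 0) ->
  upper_triangular_form TT (fun t x => (TT t (x, 0)).1)
    (fun t y => (TT t (0, y)).1) (fun t y => (TT t (0, y)).2).
Proof.
move=> inv t t0; have TB := C0_semigroup_bounded hTT.
have tl := bsg_linear TB t0; have [C tC] := bsg_bounded TB t0.
have inr_lin (a : R[i]) (x y : F) :
    ((0, a *: x + y) : (E * F)%type) = a *: (0, x) + (0, y).
  by congr pair; rewrite /= scaler0 addr0.
split.
- apply/bounded_operatorP; split=> [a x y|]; first by rewrite pair0_linear tl.
  by exists C => x; apply: le_trans (rnorm_fst _) _; rewrite -(rnorm_inl (F := F) x).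
- apply/bounded_operatorP; split=> [a x y|]; first by rewrite inr_lin tl.
  by exists C => x; apply: le_trans (rnorm_fst _) _; rewrite -(rnorm_inr (E := E) x).
- apply/bounded_operatorP; split=> [a x y|]; first by rewrite inr_lin tl.
  by exists C => x; apply: le_trans (rnorm_snd _) _; rewrite -(rnorm_inr (E := E) x).
apply/funext => -[x y]; rewrite /block_operator /=.
have -> : ((x, y) : (E * F)%type) = (x, 0) + (0, y).
  by congr pair; rewrite /= ?addr0 ?add0r.
by rewrite (linear_funD tl) [LHS]surjective_pairing /= inv.
Qed.

(** If u is the corner resolvent at x, then (i) gives (l - A)(u, 0) = (x, 0)
    for the big operator A, so B (x, 0) = (u, 0). *)
Lemma corner_resolvent_invariant (l : R[i]) (B : E * F -> E * F) :
  (forall x, op_dom AA (x, 0) -> (AA (x, 0)).2 = 0) ->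
  resolvent_set (corner_operator AA) l ->
  (forall z, op_dom AA z -> B (l *: z - AA z) = z) ->
  forall z, z.2 = 0 -> (B z).2 = 0.
Proof.
move=> A20 [G [_ GP _]] BP [x y] /= ->; have [Dx xE] := GP x.
rewrite (_ : (x, 0) = l *: (G x, 0) - AA (G x, 0)) ?BP//.
by rewrite [AA _]surjective_pairing A20//; congr pair; rewrite /= ?scaler0 ?subr0//.
Qed.

(** Invariance under the resolvents at l + s, s >= 0, is transported to the
    semigroup by the Euler scheme. The semigroup is first rescaled by m = l +
    s with s so large that it becomes contractive; one implicit Euler step of
    length h is then the resolvent at m + 1 / h applied to the vector divided
    by h. *)
Lemma triangular_of_resolvent (l : R[i]) :
  pnorm_complete (rnorm : (E * F)%type -> R) ->
  (forall x, op_dom AA (x, 0) -> (AA (x, 0)).2 = 0) ->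
  resolvent_set (corner_operator AA) l ->
  (forall s : R, 0 <= s -> resolvent_set AA (l + s%:C)) ->
  forall t x, 0 <= t -> (TT t (x, 0)).2 = 0.
Proof.
move=> VC A20 lA lsAA t x t0; have TB := C0_semigroup_bounded hTT.
have [G GP] : {G : R -> E * F -> E * F & forall s, 0 <= s ->
    [/\ bounded_operator (G s),
        forall y, op_dom AA (G s y) /\ (l + s%:C) *: G s y - AA (G s y) = y &
        forall x, op_dom AA x -> G s ((l + s%:C) *: x - AA x) = x]}.
  apply: (@choice _ _ (fun s B => 0 <= s -> [/\ bounded_operator B,
        forall y, op_dom AA (B y) /\ (l + s%:C) *: B y - AA (B y) = y &
        forall x, op_dom AA x -> B ((l + s%:C) *: x - AA x) = x])) => s.
  have [s0|ns] := pselect (0 <= s); last by exists id => /ns.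
  by have [B BP] := lsAA s s0; exists B.
have Gl s : 0 <= s -> linear (G s) by move=> /GP[[]].
have Ginv s : 0 <= s -> forall z, z.2 = 0 -> (G s z).2 = 0.
  move=> s0; have sl : linear (snd : (E * F)%type -> F) by [].
  apply: (resolvent_invariant rnorm_is_norm rnorm_is_norm sl).
  - exact: rnorm_snd.
  - by move=> u /GP[/bounded_operatorP[]].
  - move=> u v y u0 v0; have [_ GPu _] := GP u u0; have [_ _ GPv] := GP v v0.
    have [Du Eu] := GPu y; rewrite -{1}Eu.
    have -> : (l + u%:C) *: G u y - AA (G u y) =
        ((l + v%:C) *: G u y - AA (G u y)) + (u - v)%:C *: G u y by lmod.
    by rewrite (linear_funD (Gl v v0)) GPv// (linear_funZ (Gl v v0)).
  - exact: s0.
  apply: (corner_resolvent_invariant A20 lA) => z Dz.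
  by have [_ _ /(_ z Dz)] := GP 0 (lexx 0); rewrite addr0.
have [w wP] := stable_rescaling rnorm_is_norm VC TB.
pose s := Num.max 0 (w - complex.Re l).
have s0 : 0 <= s by rewrite le_max lexx.
pose m := l + s%:C.
have wm : w <= complex.Re m.
  have : w - complex.Re l <= s by rewrite le_max lexx orbT.
  by rewrite /m; case: (l) => a b /=; lra.
have [p [pN pC WC _ [M M1 qp]]] := wP m wm.
have iff := right_derivative_renorm (rescale m TT) qp M1.
pose J h z := G (s + h^-1) (h^-1%:C *: z).
have sh0 h : 0 < h -> 0 <= s + h^-1 by move=> h0; rewrite addr_ge0// invr_ge0 ltW.
have JW h z : 0 < h ->
    right_derivative p (rescale m TT) (J h z) (h^-1%:C *: (J h z - z)).
  move=> h0; apply/iff; have [_ /(_ (h^-1%:C *: z)) [D Ez] _] := GP _ (sh0 h h0).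
  have := (hAA (J h z) (AA (J h z))).1 (conj D erefl).
  move=> /right_derivative_cvgP /(rescale_right_derivative rnorm_is_norm m).
  congr right_derivative; rewrite scalerBr -[in RHS]Ez -/(J h z).
  by rewrite rmorphD /= /m; lmod.
have Winv : (rescale m TT t (x, 0)).2 = 0.
  apply: (csg_invariant pN pC WC JW (Y := [set z | z.2 = 0])) => //=.
    move=> z zY; apply: (pnorm_small0 rnorm_is_norm) => e /zY[y /= y0 zy].
    apply: le_trans zy; have /andP[h _] := qp (z - y); apply: le_trans h.
    by apply: le_trans (rnorm_snd _); rewrite /= y0 subr0.
  by move=> h z h0 z0; apply: Ginv; [exact: sh0 | rewrite /= z0 scaler0].
rewrite -(rescaleK m TT) {1}/rescale /=.
by move: Winv => /= ->; rewrite scaler0.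
Qed.

End Corner.

Theorem proposition2p1 (R : realType) (E F : completeNormedModType R[i])
    (AA : unbounded_operator (E * F)%type) (TT : R -> E * F -> E * F)
    (hTT : C0_semigroup TT) (hAA : is_generator TT AA) :
  ((exists (T : R -> E -> E) (U : R -> F -> E) (S : R -> F -> F),
      upper_triangular_form TT T U S)
   <->
   ((forall x : E, op_dom AA (x, 0) -> (AA (x, 0)).2 = 0) /\
    (exists2 lambda : R[i], resolvent_set (corner_operator AA) lambda &
       (spectral_bound AA < (complex.Re lambda)%:E)%E)))
  /\
  (forall (T : R -> E -> E) (U : R -> F -> E) (S : R -> F -> F),
     upper_triangular_form TT T U S ->
     C0_semigroup T /\ is_generator T (corner_operator AA)).
Proof.
have EC := rnorm_complete (E := E); have FC := rnorm_complete (E := F).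
have VC := rnorm_complete_prod EC FC.
have corner T U S : upper_triangular_form TT T U S ->
    C0_semigroup T /\ is_generator T (corner_operator AA).
  by move=> tri; split;
    [exact: triangular_semigroup tri | exact: triangular_generator tri].
split=> //; split=> [[T [U [S tri]]]|[A20 [l lA sl]]].
  split; first by move=> x; exact: triangular_generator_snd tri x.
  have [TC gA] := corner _ _ _ tri.
  have [w1 w1P] := generator_resolvent EC TC gA.
  have [w2 w2P] := generator_resolvent VC hTT hAA.
  exists (Num.max w1 (w2 + 1))%:C; first by apply: w1P; rewrite /= le_max lexx.
  apply: (@le_lt_trans _ _ w2%:E).
    apply: ge_ereal_sup => _ [mu mus <-]; rewrite lee_fin leNgt.
    by apply/negP => /ltW /w2P.
  by rewrite lte_fin /= lt_max ltrDl ltr01 orbT.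
exists (fun t x => (TT t (x, 0)).1), (fun t y => (TT t (0, y)).1),
  (fun t y => (TT t (0, y)).2); apply: block_decomposition => // t x t0.
apply: (triangular_of_resolvent hTT hAA VC A20 lA _ x t0) => s s0.
apply: contrapT => nls; move: sl; apply/negP; rewrite -leNgt.
apply: (@le_trans _ _ (complex.Re (l + s%:C))%:E).
  by rewrite lee_fin; case: (l) => a b /=; rewrite lerDl.
by apply: ereal_sup_ubound; exists (l + s%:C).
Qed.
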